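(* Let $(A_k,\gamma_k)$ be an inductive system of separable $C^*$-algebras. Then there exists an inductive system $(B_k,\delta_k)$ with surjective connecting morphisms and such that $\varinjlim A_k\cong\varinjlim B_k$. Moreover, we may assume that $B_k=A_k\ast\mathcal{F}_\infty$ (the free product), where $$\mathcal{F}_\infty:=C^*(x_1,x_2,\ldots : \|x_i\|\leq 1)$$ is the universal $C^*$-algebra generated by a countable number of contractive generators. If $A_k$ is projective (respectively, semiprojective), then so is $A_k\ast\mathcal{F}_\infty$.
   Context: A morphism between $C^*$-algebras is a $*$-homomorphism (not assumed unital); ideals are closed and two-sided. An inductive system $(A_k,\gamma_k)$ is sequential: $C^*$-algebras $A_1,A_2,\ldots$ with connecting morphisms $\gamma_k\colon A_k\to A_{k+1}$. The free product $A\ast B$ is the coproduct in the category of $C^*$-algebras and (not necessarily unital) $*$-homomorphisms. A $C^*$-algebra $A$ is projective if for every $C^*$-algebra $C$, ideal $J\lhd C$ and morphism $\sigma\colon A\to C/J$ there is a morphism $\psi\colon A\to C$ with $\pi\circ\psi=\sigma$, where $\pi\colon C\to C/J$ is the quotient morphism. $A$ is semiprojective if for every $C^*$-algebra $C$, increasing sequence of ideals $J_1\subseteq J_2\subseteq\cdots$ of $C$ and morphism $\sigma\colon A\to C/\overline{\bigcup_k J_k}$, there exist an index $k$ and a morphism $\psi\colon A\to C/J_k$ with $\pi_k\circ\psi=\sigma$, where $\pi_k\colon C/J_k\to C/\overline{\bigcup_k J_k}$ is the quotient morphism. *)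

(* Defs.v *)
From HB Require Import structures.
From mathcomp Require Import all_boot all_order all_algebra.
From mathcomp Require Import complex.
From mathcomp Require Import all_classical all_reals all_analysis.

Set Implicit Arguments.
Unset Strict Implicit.
Unset Printing Implicit Defensive.

Import Order.TTheory GRing.Theory Num.Theory.
Import numFieldNormedType.Exports.

Local Open Scope classical_set_scope.
Local Open Scope ring_scope.
Local Open Scope complex_scope.

Reserved Notation "x *c y" (at level 40, left associativity).
Reserved Notation "A ~*> B" (at level 70, no associativity).

(* MathComp's algebras all have a unit and C*-algebras need not have one, so
   the product is part of the mixin.  Norms take their values in the
   nonnegative real elements of R[i]. *)
HB.mixin Record CompleteNormedModule_isCStarAlgebra (R : realType) A
    of CompleteNormedModule R[i] A := {
  cmul : A -> A -> A;
  star : A -> A;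
  cmulA : associative cmul;
  cmulDl : left_distributive cmul +%R;
  cmulDr : right_distributive cmul +%R;
  cmulZl : forall (c : R[i]) (x y : A), cmul (c *: x) y = c *: cmul x y;
  cmulZr : forall (c : R[i]) (x y : A), cmul x (c *: y) = c *: cmul x y;
  starK : involutive star;
  starD : {morph star : x y / x + y};
  starZ : forall (c : R[i]) (x : A), star (c *: x) = c^* *: star x;
  starM : forall x y : A, star (cmul x y) = cmul (star y) (star x);
  normcM : forall x y : A, `|cmul x y| <= `|x| * `|y|;
  cstar_identity : forall x : A, `|cmul (star x) x| = `|x| ^+ 2
}.

#[short(type="cstarAlgType")]
HB.structure Definition CStarAlgebra (R : realType) :=
  {A of CompleteNormedModule_isCStarAlgebra R A & CompleteNormedModule R[i] A}.

Notation "x *c y" := (cmul x y) : ring_scope.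

Definition separable (R : realType) (A : cstarAlgType R) : Prop :=
  exists2 D : set A, countable D & dense D.

Record star_hom (R : realType) (A B : cstarAlgType R) := StarHom {
  star_hom_fun :> A -> B;
  star_homP : linear star_hom_fun;
  star_homM : {morph star_hom_fun : x y / x *c y};
  star_hom_star : {morph star_hom_fun : x / star x}
}.

Notation "A ~*> B" := (star_hom A B) : type_scope.

Definition isomorphic (R : realType) (A B : cstarAlgType R) : Prop :=
  exists (f : A ~*> B) (g : B ~*> A), cancel f g /\ cancel g f.

Definition is_ideal (R : realType) (C : cstarAlgType R) (J : set C) : Prop :=
  [/\ J 0,
      forall (c : R[i]) (x y : C), J x -> J y -> J (c *: x + y),
      forall x y : C, J x -> J (y *c x) /\ J (x *c y) &
      closed J].

(* [Q], with quotient morphism [p], is C / J with its quotient norm. *)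
Definition is_quotient (R : realType) (C : cstarAlgType R) (J : set C)
    (Q : cstarAlgType R) (p : C ~*> Q) : Prop :=
  [/\ range p = setT,
      forall x, p x = 0 <-> J x &
      forall x, infimums [set `|x + j| | j in J] `|p x|].

Definition projective (R : realType) (A : cstarAlgType R) : Prop :=
  forall (C : cstarAlgType R) (J : set C) (Q : cstarAlgType R) (p : C ~*> Q),
  is_ideal J -> is_quotient J p ->
  forall s : A ~*> Q, exists t : A ~*> C, forall a, p (t a) = s a.

(* [Q k] and [Qoo] are the quotients of C by [J k] and by the closed union of
   the [J k]; [r k] is the quotient morphism between them. *)
Definition semiprojective (R : realType) (A : cstarAlgType R) : Prop :=
  forall (C : cstarAlgType R) (J : nat -> set C)
    (Q : nat -> cstarAlgType R) (q : forall k, C ~*> Q k)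
    (Qoo : cstarAlgType R) (qoo : C ~*> Qoo) (r : forall k, Q k ~*> Qoo),
  (forall k, is_ideal (J k)) ->
  (forall k, J k `<=` J k.+1) ->
  (forall k, is_quotient (J k) (q k)) ->
  is_quotient (closure (\bigcup_k J k)) qoo ->
  (forall k c, r k (q k c) = qoo c) ->
  forall s : A ~*> Qoo,
  exists k, exists t : A ~*> Q k, forall a, r k (t a) = s a.

Definition is_cocone (R : realType) (A : nat -> cstarAlgType R)
    (g : forall k, A k ~*> A k.+1) (L : cstarAlgType R)
    (i : forall k, A k ~*> L) : Prop :=
  forall k a, i k.+1 (g k a) = i k a.

Definition is_inductive_limit (R : realType) (A : nat -> cstarAlgType R)
    (g : forall k, A k ~*> A k.+1) (L : cstarAlgType R)
    (i : forall k, A k ~*> L) : Prop :=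
  is_cocone g i /\
  forall (D : cstarAlgType R) (f : forall k, A k ~*> D), is_cocone g f ->
  (exists h : L ~*> D, forall k a, h (i k a) = f k a) /\
  (forall h h' : L ~*> D, (forall k a, h (i k a) = f k a) ->
    (forall k a, h' (i k a) = f k a) -> h =1 h').

Definition is_free_product (R : realType) (A B P : cstarAlgType R)
    (i : A ~*> P) (j : B ~*> P) : Prop :=
  forall (D : cstarAlgType R) (f : A ~*> D) (g : B ~*> D),
  (exists h : P ~*> D, (forall a, h (i a) = f a) /\ (forall b, h (j b) = g b)) /\
  (forall h h' : P ~*> D,
    (forall a, h (i a) = f a) -> (forall b, h (j b) = g b) ->
    (forall a, h' (i a) = f a) -> (forall b, h' (j b) = g b) -> h =1 h').

(* C*(x_0, x_1, ... : |x_n| <= 1), with generators [x]. *)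
Definition is_universal_contractions (R : realType) (F : cstarAlgType R)
    (x : nat -> F) : Prop :=
  (forall n, `|x n| <= 1) /\
  forall (D : cstarAlgType R) (y : nat -> D), (forall n, `|y n| <= 1) ->
  (exists h : F ~*> D, forall n, h (x n) = y n) /\
  (forall h h' : F ~*> D, (forall n, h (x n) = y n) ->
    (forall n, h' (x n) = y n) -> h =1 h').

(* Main.v *)
Require Import Defs.
From HB Require Import structures.
From mathcomp Require Import all_boot all_order all_algebra.
From mathcomp Require Import complex ring lra.
From mathcomp Require Import all_classical all_reals all_analysis.

(* The connecting morphism B_k -> B_{k+1} extends A_k -> A_{k+1} -> B_{k+1} and
   sends x_n to d_n, where (d_n) is dense in the unit ball of the separable
   algebra B_{k+1}.  Every element of the ball is then a series in the d_n with
   geometrically decreasing coefficients, which lifts to B_k, so the morphism is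
   onto.  The sequence is enumerated so that d_n only involves A_{k+1} and the
   x_j with j < n; hence x_n is mapped into A after n + 1 steps and both systems
   have the same limit.

   Projectivity passes from A to A * F_infty because a surjective *-homomorphism
   maps closed unit balls onto closed unit balls.  This, and the contractivity
   of *-homomorphisms, is obtained without spectral theory: square roots
   1 - sqrt(1 - a) come from a norm-majorized iteration, and norm bounds from
   the identity |b + id|^2 = |b^2 + d^2| for commuting selfadjoint b, d.

   Universal C*-algebras are completions of the algebra of *-polynomials for the
   supremum of the norms of all admissible evaluations. *)

Set Implicit Arguments.
Unset Strict Implicit.
Unset Printing Implicit Defensive.

Import Order.TTheory GRing.Theory Num.Theory.
Import numFieldNormedType.Exports.

Local Open Scope classical_set_scope.
Local Open Scope ring_scope.
Local Open Scope complex_scope.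
Local Open Scope quotient_scope.

(** The delicate point is to lift a contraction to an element of norm at most 1, since truncating an
    arbitrary lift would call for functional calculus. The substitute is f(t) = sqrt (2 / (1 +
    t^2)): the function t f(t)^2 = 2t / (1 + t^2) is at most 1 for every real t, yet maps [0, 1]
    onto itself. A contraction can thus be written z f(z*z), the factor z lifted arbitrarily to c,
    and c f(c*c) is contractive whatever c is. Its ingredients solve quadratic or linear equations,
    so their images are identified by cancellation. There is no unit: 1 - k appears only as the map
    sending y to [y - k *c y], and positivity of c^2 only as the bound t^2 on the norm of
    multiplication by t^2 - c^2.

    The index bound on d_n is what keeps the limit unchanged: without it the image of a generator
    could involve new generators at every stage and never be absorbed by the A_k. *)

(* The square-zero extension of the scalars by a module is a commutative ring,
   so linear identities in the module can be left to [ring]. *)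
Definition sqzero (K : comNzRingType) (V : lmodType K) : Type := (K * V)%type.

Section SquareZero.
Variables (K : comNzRingType) (V : lmodType K).
Local Notation E := (sqzero V).

HB.instance Definition _ := GRing.Zmodule.copy E (K * V)%type.

Definition sqzero_one : E := (1, 0).
Definition sqzero_mul (x y : E) : E := (x.1 * y.1, x.1 *: y.2 + y.1 *: x.2).

Fact sqzero_mulA : associative sqzero_mul.
Proof.
move=> [a u] [b v] [c w]; congr pair; first exact: mulrA.
by rewrite /= !scalerDr !scalerA !addrA (mulrC c a) (mulrC c b).
Qed.

Fact sqzero_mulC : commutative sqzero_mul.
Proof. by move=> [a u] [b v]; congr pair; [exact: mulrC | exact: addrC]. Qed.

Fact sqzero_mul1 : left_id sqzero_one sqzero_mul.
Proof. by move=> [a u]; congr pair; rewrite /= (mul1r, scale1r) ?scaler0 ?addr0. Qed.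

Fact sqzero_mulD : left_distributive sqzero_mul +%R.
Proof.
move=> [a u] [b v] [c w]; congr pair; first exact: mulrDl.
by rewrite /= scalerDl scalerDr addrACA.
Qed.

Fact sqzero_neq0 : sqzero_one != 0.
Proof. by apply/eqP => -[/eqP]; rewrite oner_eq0. Qed.

HB.instance Definition _ := GRing.Zmodule_isComNzRing.Build E
  sqzero_mulA sqzero_mulC sqzero_mul1 sqzero_mulD sqzero_neq0.

Definition sqzero_vec (v : V) : E := (0, v).
Definition sqzero_scal (a : K) : E := (a, 0).

Lemma sqzero_vecD u v : sqzero_vec (u + v) = sqzero_vec u + sqzero_vec v.
Proof. by congr pair; rewrite addr0. Qed.

Lemma sqzero_vecN u : sqzero_vec (- u) = - sqzero_vec u.
Proof. by congr pair; rewrite oppr0. Qed.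

Lemma sqzero_vec0 : sqzero_vec 0 = 0.
Proof. by []. Qed.

Lemma sqzero_vecMn u n : sqzero_vec (u *+ n) = sqzero_vec u *+ n.
Proof. by elim: n => // n IH; rewrite !mulrS sqzero_vecD IH. Qed.

Lemma sqzero_vecZ a u : sqzero_vec (a *: u) = sqzero_scal a * sqzero_vec u.
Proof. by congr pair; rewrite /= ?mulr0 ?scaler0 ?addr0. Qed.

Lemma sqzero_scalD a b : sqzero_scal (a + b) = sqzero_scal a + sqzero_scal b.
Proof. by congr pair; rewrite addr0. Qed.

Lemma sqzero_scalN a : sqzero_scal (- a) = - sqzero_scal a.
Proof. by congr pair; rewrite oppr0. Qed.

Lemma sqzero_scalM a b : sqzero_scal (a * b) = sqzero_scal a * sqzero_scal b.
Proof. by congr pair; rewrite /= !scaler0 addr0. Qed.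

Lemma sqzero_scal1 : sqzero_scal 1 = 1.
Proof. by []. Qed.

Lemma sqzero_scal0 : sqzero_scal 0 = 0.
Proof. by []. Qed.

Lemma sqzero_scalMn a n : sqzero_scal (a *+ n) = sqzero_scal a *+ n.
Proof. by elim: n => // n IH; rewrite !mulrS sqzero_scalD IH. Qed.

Lemma sqzero_inj u v : sqzero_vec u = sqzero_vec v -> u = v.
Proof. by case. Qed.

Definition sqzeroE := (sqzero_vecD, sqzero_vecN, sqzero_vec0, sqzero_vecMn,
  sqzero_vecZ, sqzero_scalD, sqzero_scalN, sqzero_scalM, sqzero_scal1,
  sqzero_scal0, sqzero_scalMn).

End SquareZero.

Ltac lmod := apply: sqzero_inj; rewrite !sqzeroE; ring.

(** * Real-valued norms and sequential limits *)

Section RealNorm.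
Variables (R : realType) (A : cstarAlgType R).
Implicit Types (x y : A) (c : R[i]) (r : R).

Definition nrm x : R := complex.Re `|x|.

Lemma normE x : `|x| = (nrm x)%:C.
Proof. by rewrite RRe_real// normr_real. Qed.

Lemma nrm_ge0 x : 0 <= nrm x.
Proof. by rewrite -lecR -normE normr_ge0. Qed.

Lemma nrm0 : nrm 0 = 0.
Proof. by rewrite /nrm normr0. Qed.

Lemma nrm_eq0 x : nrm x <= 0 -> x = 0.
Proof.
move=> x0; apply/normr0_eq0; rewrite normE; congr _%:C.
by apply/eqP; rewrite eq_le x0 nrm_ge0.
Qed.

Lemma nrmD x y : nrm (x + y) <= nrm x + nrm y.
Proof. by rewrite -lecR rmorphD/= -!normE ler_normD. Qed.

Lemma nrmN x : nrm (- x) = nrm x.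
Proof. by rewrite /nrm normrN. Qed.

Lemma nrmB x y : nrm (x - y) <= nrm x + nrm y.
Proof. by rewrite -(nrmN y) nrmD. Qed.

Lemma nrm_distC x y : nrm (x - y) = nrm (y - x).
Proof. by rewrite -nrmN opprB. Qed.

Lemma nrm_distD y x z : nrm (x - z) <= nrm (x - y) + nrm (y - z).
Proof. by rewrite -(subrK y x) -addrA (le_trans (nrmD _ _))// subrK. Qed.

Lemma nrmZ c x : nrm (c *: x) = Normc.normc c * nrm x.
Proof. by apply: (@complexI R); rewrite rmorphM/= -!normE normrZ. Qed.

Lemma nrmZr r x : nrm (r%:C *: x) = `|r| * nrm x.
Proof. by rewrite nrmZ /= expr0n addr0 sqrtr_sqr. Qed.

Lemma nrmZi x : nrm ('i *: x) = nrm x.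
Proof. by rewrite nrmZ /= expr0n add0r expr1n sqrtr1 mul1r. Qed.

Lemma nrmMn x n : nrm (x *+ n) = nrm x *+ n.
Proof.
have -> : x *+ n = n%:R%:C *: x by rewrite rmorph_nat scaler_nat.
by rewrite nrmZr ger0_norm// mulr_natl.
Qed.

Lemma nrmM x y : nrm (x *c y) <= nrm x * nrm y.
Proof. by rewrite -lecR rmorphM/= -!normE normcM. Qed.

Lemma nrm_cstar x : nrm (star x *c x) = nrm x ^+ 2.
Proof. by apply: (@complexI R); rewrite rmorphXn/= -!normE cstar_identity. Qed.

Lemma nrm_star x : nrm (star x) = nrm x.
Proof.
suff H y : nrm y <= nrm (star y).
  by apply/eqP; rewrite eq_le H -{2}[x]starK H.
have [y0|y0] := ltP 0 (nrm y); last exact: le_trans y0 (nrm_ge0 _).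
by rewrite -(ler_pM2r y0) -expr2 -nrm_cstar nrmM.
Qed.

Lemma cmul0x x : 0 *c x = 0.
Proof. by rewrite -(scale0r (0 : A)) cmulZl !scale0r. Qed.

Lemma cmulx0 x : x *c 0 = 0.
Proof. by rewrite -(scale0r (0 : A)) cmulZr !scale0r. Qed.

Lemma cmulNx x y : (- x) *c y = - (x *c y).
Proof. by rewrite -scaleN1r cmulZl scaleN1r. Qed.

Lemma cmulxN x y : x *c (- y) = - (x *c y).
Proof. by rewrite -scaleN1r cmulZr scaleN1r. Qed.

Lemma cmulMnx x y n : (x *+ n) *c y = (x *c y) *+ n.
Proof. by elim: n => [|n IH]; rewrite ?cmul0x// !mulrS cmulDl IH. Qed.

Lemma cmulxMn x y n : x *c (y *+ n) = (x *c y) *+ n.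
Proof. by elim: n => [|n IH]; rewrite ?cmulx0// !mulrS cmulDr IH. Qed.

Definition cmulE := (@cmulDl, @cmulDr, cmulNx, cmulxN, @cmulZl, @cmulZr,
  cmulMnx, cmulxMn, cmul0x, cmulx0).

Lemma conjCE (c : R[i]) : Num.conj c = conjc c.
Proof. by []. Qed.

Lemma star0 : star 0 = 0 :> A.
Proof. by rewrite -(scale0r (0 : A)) starZ conjC0 !scale0r. Qed.

Lemma starN x : star (- x) = - star x.
Proof. by rewrite -scaleN1r starZ conjCN1 scaleN1r. Qed.

Lemma starZr r x : star (r%:C *: x) = r%:C *: star x.
Proof. by rewrite starZ conjCE conjc_real. Qed.

Lemma starZi x : star ('i *: x) = - ('i *: star x).
Proof. by rewrite starZ conjCE -scaleNr; congr (_ *: _); rewrite /GRing.opp/= oppr0. Qed.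

Definition tends (u : nat -> A) (l : A) :=
  forall e : R, 0 < e -> exists N, forall n, (N <= n)%N -> nrm (u n - l) < e.

Lemma nrm_complete (u : nat -> A) :
  (forall e : R, 0 < e ->
    exists N, forall m n, (N <= m)%N -> (N <= n)%N -> nrm (u m - u n) < e) ->
  exists l, tends u l.
Proof.
move=> cu; have /cvg_ex[l ul] : cvg (u @ \oo).
  apply/cauchy_cvgP; apply: cauchy_exP => e e0.
  have eE : (complex.Re e)%:C = e by rewrite RRe_real// gtr0_real.
  have [|N uN] := cu (complex.Re e); first by rewrite -ltcR eE.
  exists (u N), N => // n Nn /=; rewrite -ball_normE/= normE -eE ltcR.
  exact: uN.
exists l => e e0; move/cvgrPdist_lt : ul => /(_ e%:C).
rewrite ltcR => /(_ e0)[N _ uN]; exists N => n Nn.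
by rewrite nrm_distC -ltcR -normE; exact: uN.
Qed.

Lemma nrm_le_eps x y : (forall e : R, 0 < e -> nrm (x - y) < e) -> x = y.
Proof.
move=> xy; apply/eqP; rewrite -subr_eq0; apply/eqP/nrm_eq0.
by rewrite leNgt; apply/negP => /xy; rewrite ltxx.
Qed.

Lemma tends_uniq u l l' : tends u l -> tends u l' -> l = l'.
Proof.
move=> ul ul'; apply: nrm_le_eps => e e0.
have [|N uN] := ul (e / 2); first by rewrite divr_gt0.
have [|N' uN'] := ul' (e / 2); first by rewrite divr_gt0.
have := uN (maxn N N') (leq_maxl _ _); have := uN' (maxn N N') (leq_maxr _ _).
move: (u _) => v v2 v1; apply: le_lt_trans (nrm_distD v _ _) _.
by rewrite (splitr e) ltrD// nrm_distC.
Qed.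

Lemma tends_cst x : tends (fun=> x) x.
Proof. by move=> e e0; exists 0%N => n _; rewrite subrr nrm0. Qed.

Lemma tendsS u l : tends u l -> tends (fun n => u n.+1) l.
Proof. by move=> ul e /ul[N uN]; exists N => n Nn; apply/uN/leqW. Qed.

End RealNorm.

Lemma tends_dom (R : realType) (A B : cstarAlgType R) (u : nat -> A) (l : A)
    (u' : nat -> B) (l' : B) (C : R) : tends u' l' ->
  (forall n, nrm (u n - l) <= C * nrm (u' n - l')) -> tends u l.
Proof.
move=> ul uu e e0; have C0 : 0 < `|C| + 1 by rewrite ltr_pwDr.
have [|N uN] := ul (e / (`|C| + 1)); first by rewrite divr_gt0.
exists N => n /uN; rewrite ltr_pdivlMr//; apply: le_lt_trans.
apply: le_trans (uu n) _; rewrite mulrC ler_wpM2l ?nrm_ge0//.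
by rewrite (le_trans (ler_norm _))// lerDl.
Qed.

Section Limits.
Variables (R : realType) (A : cstarAlgType R).
Implicit Types (x y : A) (c : R[i]) (u : nat -> A).

Lemma tendsZ c u l : tends u l -> tends (fun n => c *: u n) (c *: l).
Proof.
by move=> ul; apply: (tends_dom (C := Normc.normc c) ul) => n; rewrite -scalerBr nrmZ.
Qed.

Lemma tends_star u l : tends u l -> tends (fun n => star (u n)) (star l).
Proof.
move=> ul; apply: (tends_dom (C := 1) ul) => n.
by rewrite -starN -starD nrm_star mul1r.
Qed.

Lemma tendsD u l u' l' :
  tends u l -> tends u' l' -> tends (fun n => u n + u' n) (l + l').
Proof.
move=> ul ul' e e0.
have [|N uN] := ul (e / 2); first by rewrite divr_gt0.
have [|N' uN'] := ul' (e / 2); first by rewrite divr_gt0.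
exists (maxn N N') => n; rewrite geq_max => /andP[/uN u1 /uN' u2].
by rewrite opprD addrACA (le_lt_trans (nrmD _ _))// (splitr e) ltrD.
Qed.

Lemma tendsMl x u l : tends u l -> tends (fun n => x *c u n) (x *c l).
Proof.
by move=> ul; apply: (tends_dom (C := nrm x) ul) => n; rewrite -cmulxN -cmulDr nrmM.
Qed.

Lemma tendsMr x u l : tends u l -> tends (fun n => u n *c x) (l *c x).
Proof.
move=> ul; apply: (tends_dom (C := nrm x) ul) => n.
by rewrite -cmulNx -cmulDl mulrC nrmM.
Qed.

Lemma tends_bounded u l : tends u l ->
  exists2 N, 0 < nrm l + 1 & forall n, (N <= n)%N -> nrm (u n) <= nrm l + 1.
Proof.
move=> /(_ 1 ltr01)[N uN]; exists N; first by rewrite ltr_wpDl ?nrm_ge0.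
move=> n /uN un; rewrite -(subrK l (u n)) (le_trans (nrmD _ _))//.
by rewrite addrC lerD2l ltW.
Qed.

Lemma tendsM u l u' l' :
  tends u l -> tends u' l' -> tends (fun n => u n *c u' n) (l *c l').
Proof.
move=> ul ul' e e0; have [M b0 uM] := tends_bounded ul.
have [|N uN] := tendsMr l' ul (e := e / 2); first by rewrite divr_gt0.
have [|N' uN'] := ul' (e / 2 / (nrm l + 1)); first by rewrite !divr_gt0.
exists (maxn M (maxn N N')) => n; rewrite !geq_max => /and3P[/uM un /uN u1 /uN' u2].
rewrite (_ : _ - _ = u n *c (u' n - l') + (u n *c l' - l *c l')); last first.
  by rewrite !cmulE; lmod.
apply: le_lt_trans (nrmD _ _) _; rewrite (splitr e) ltrD//.
apply: le_lt_trans (nrmM _ _) _; move: u2; rewrite ltr_pdivlMr// mulrC.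
by apply: le_lt_trans; rewrite ler_wpM2r ?nrm_ge0.
Qed.

Lemma tends_nrm_le u l (C : R) : tends u l ->
  (exists N, forall n, (N <= n)%N -> nrm (u n) <= C) -> nrm l <= C.
Proof.
move=> ul [N uC]; apply/ler_addgt0Pr => e /ul[M uM].
have := uM _ (leq_maxr N M); have := uC _ (leq_maxl N M); move: (u _) => v vC ve.
rewrite -(subrK v l) (le_trans (nrmD _ _))// addrC lerD// nrm_distC.
exact: ltW.
Qed.

End Limits.

(** * Fixed points of majorized iterations *)

Section Iteration.
Variables (R : realType) (A : cstarAlgType R).
Implicit Types (T : A -> A) (S : set A) (kappa : nat -> R).

(** Kantorovich's majorant principle: the increments telescope against a bounded nondecreasing real
    sequence, so no geometric rate is required. *)
Lemma majorized_cvg (u : nat -> A) kappa (M : R) :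
  (forall n, nrm (u n.+1 - u n) <= kappa n.+1 - kappa n) ->
  (forall n, kappa n <= M) -> exists l, tends u l.
Proof.
move=> ku kM.
have uk N d : nrm (u (N + d)%N - u N) <= kappa (N + d)%N - kappa N.
  elim: d => [|d IH]; first by rewrite addn0 !subrr nrm0.
  rewrite addnS (le_trans (nrm_distD (u (N + d)%N) _ _))//.
  have -> : kappa (N + d).+1 - kappa N =
    (kappa (N + d).+1 - kappa (N + d)%N) + (kappa (N + d)%N - kappa N) by ring.
  exact: lerD.
have ks : has_sup (range kappa).
  by split; [exists (kappa 0%N), 0%N | exists M => _ [n _ <-]].
apply: nrm_complete => e e0.
have [|_ [N _ <-] kN] := sup_adherent (eps := e / 2) _ ks.
  by rewrite divr_gt0.
have uN n : (N <= n)%N -> nrm (u n - u N) < e / 2.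
  move=> /subnKC <-; apply: le_lt_trans (uk _ _) _.
  rewrite ltrBlDr -ltrBlDl; apply: le_lt_trans kN.
  by rewrite lerD2r; apply: ub_le_sup; [case: ks | exists (N + (n - N))%N].
exists N => m n Nm Nn; apply: le_lt_trans (nrm_distD (u N) _ _) _.
by rewrite (splitr e) ltrD// ?uN// nrm_distC uN.
Qed.

Lemma iter_fixpoint T S kappa (M : R) :
  S 0 -> (forall v, S v -> S (T v)) ->
  (forall u l, (forall n, S (u n)) -> tends u l -> S l) ->
  (forall u l, tends u l -> tends (T \o u) (T l)) ->
  (forall n, nrm (iter n.+1 T 0 - iter n T 0) <= kappa n.+1 - kappa n) ->
  (forall n, kappa n <= M) -> exists2 l, S l & T l = l.
Proof.
move=> S0 TS clS cT ku kM; have [l ul] := majorized_cvg ku kM.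
exists l; first by apply: clS ul => n; elim: n => //= n; exact: TS.
by apply: (tends_uniq (cT _ _ ul)); exact: (tendsS ul).
Qed.

Lemma contraction_fix T S (q : R) : 0 <= q < 1 ->
  (forall v w, nrm (T v - T w) <= q * nrm (v - w)) ->
  S 0 -> (forall v, S v -> S (T v)) ->
  (forall u l, (forall n, S (u n)) -> tends u l -> S l) ->
  exists2 l, S l & T l = l.
Proof.
move=> /andP[q0 q1] Tq S0 TS clS; have q1' : 0 < 1 - q by rewrite subr_gt0.
(* The majorant is the sequence of partial sums of the geometric series with terms
   [q ^+ i * nrm (T 0)]. *)
apply: (@iter_fixpoint T S (fun n => (1 - q ^+ n) / (1 - q) * nrm (T 0))
  ((1 - q)^-1 * nrm (T 0))) => //.
- by move=> u l ul; exact: (tends_dom ul (fun n => Tq _ _)).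
- move=> n; have -> : (1 - q ^+ n.+1) / (1 - q) * nrm (T 0) -
      (1 - q ^+ n) / (1 - q) * nrm (T 0) = q ^+ n * nrm (T 0).
    by rewrite exprS; field; rewrite gt_eqF.
  elim: n => [|n IH]; first by rewrite subr0 mul1r.
  by rewrite iterS (le_trans (Tq _ _))// exprS -mulrA ler_wpM2l.
- move=> n; rewrite ler_wpM2r ?nrm_ge0// ler_pdivrMr// mulVf ?gt_eqF//.
  by rewrite lerBlDr lerDl exprn_ge0.
Qed.

(* Elements of the form f(a) for a selfadjoint a are selfadjoint and commute
   with everything that commutes with a; this replaces functional calculus. *)
Definition sa_func (a : A) : set A :=
  [set v | star v = v /\ forall x, a *c x = x *c a -> v *c x = x *c v].

Lemma sa_func_id a : star a = a -> sa_func a a.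
Proof. by []. Qed.

Lemma sa_func_comm a v w : sa_func a v -> sa_func a w -> v *c w = w *c v.
Proof. by move=> [_ va] [_ wa]; apply: va; apply/esym/wa. Qed.

Lemma sa_func0 a : sa_func a 0.
Proof. by split=> [|x _]; rewrite ?star0// !cmulE. Qed.

Lemma sa_funcD a v w : sa_func a v -> sa_func a w -> sa_func a (v + w).
Proof.
move=> [vs va] [ws wa]; split=> [|x ax]; first by rewrite starD vs ws.
by rewrite !cmulE va// wa.
Qed.

Lemma sa_funcZ a (r : R) v : sa_func a v -> sa_func a (r%:C *: v).
Proof.
move=> [vs va]; split=> [|x ax]; first by rewrite starZr vs.
by rewrite !cmulE va.
Qed.

Lemma sa_funcN a v : sa_func a v -> sa_func a (- v).
Proof.
move=> [vs va]; split=> [|x ax]; first by rewrite starN vs.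
by rewrite !cmulE va.
Qed.

Lemma sa_funcM a v w : sa_func a v -> sa_func a w -> sa_func a (v *c w).
Proof.
move=> av aw; have vw := sa_func_comm av aw; case: av aw => vs va [ws wa].
split=> [|x ax]; first by rewrite starM vs ws.
by rewrite -cmulA wa// cmulA va// cmulA.
Qed.

Lemma sa_func_trans a b v : sa_func a b -> sa_func b v -> sa_func a v.
Proof. by move=> [_ ba] [vs vb]; split=> // x /ba /vb. Qed.

Lemma sa_func_lim a (u : nat -> A) l :
  (forall n, sa_func a (u n)) -> tends u l -> sa_func a l.
Proof.
move=> au ul; split=> [|x ax].
  by apply: (tends_uniq (tends_star ul)) => e /ul[N uN]; exists N => n /uN;
    case: (au n) => ->.
apply: (tends_uniq (tendsMr x ul)) => e /(tendsMl x ul)[N uN].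
by exists N => n /uN; case: (au n) => _ ->.
Qed.

(* The scalar iteration kappa -> (r + kappa^2) / 2 majorizes the one in A, also
   in the borderline case r = rho = 1 where there is no strict contraction. *)
Lemma quadratic_fix (a : A) (P : A -> A) (r rho : R) :
  0 <= rho -> nrm a <= r -> r + rho ^+ 2 <= rho *+ 2 ->
  star a = a -> {morph P : x y / x - y} -> (forall x, nrm (P x) <= nrm x) ->
  (forall v, sa_func a v -> sa_func a (P v)) ->
  exists2 v, sa_func a v /\ nrm v <= rho & v *+ 2 = a + P (v *c v).
Proof.
move=> rho0 ar rrho sa PB Pn PS.
have r0 : 0 <= r by exact: le_trans (nrm_ge0 _) ar.
pose half : R := 2^-1; have h0 : 0 <= half by rewrite invr_ge0.
have h2 : half + half = 1 by rewrite /half; lra.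
(* [P] will be the identity for square roots, and multiplication by [h] in [contraction_decomp]. *)
pose T v : A := half%:C *: (a + P (v *c v)).
pose kappa n := iter n (fun k => half * (r + k ^+ 2)) 0.
have kS n : kappa n.+1 = half * (r + kappa n ^+ 2) by [].
have k0 n : 0 <= kappa n.
  by case: n => //= n; rewrite mulr_ge0// addr_ge0// sqr_ge0.
have TB v w : nrm (T v - T w) <= half * (nrm v + nrm w) * nrm (v - w).
  have -> : T v - T w = half%:C *: P (v *c v - w *c w) by rewrite PB /T; lmod.
  rewrite nrmZr ger0_norm// -mulrA ler_wpM2l// (le_trans (Pn _))//.
  have -> : v *c v - w *c w = v *c (v - w) + (v - w) *c w by rewrite !cmulE; lmod.
  apply: le_trans (nrmD _ _) _; rewrite mulrDl lerD// ?nrmM//.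
  by rewrite (mulrC (nrm w)) nrmM.
have Tn v k : nrm v <= k -> nrm (T v) <= half * (r + k ^+ 2).
  move=> vk; rewrite nrmZr ger0_norm// ler_wpM2l//.
  rewrite (le_trans (nrmD _ _))// lerD// (le_trans (Pn _))//.
  by rewrite (le_trans (nrmM _ _))// expr2 ler_pM ?nrm_ge0.
have uk n : nrm (iter n T 0) <= kappa n.
  by elim: n => [|n IH]; rewrite ?nrm0//=; exact: Tn.
(* The hypothesis on [r] and [rho] makes [rho] a supersolution of the scalar iteration, which
   therefore stays below it. *)
have krho n : kappa n <= rho.
  elim: n => //= n IH; rewrite -(ler_pMn2r (n := 2))// (le_trans _ rrho)//.
  rewrite mulr2n -mulrDl h2 mul1r lerD2l; apply: lerXn2r => //; exact: k0.
have [||||||v Sv vE] := @iter_fixpoint T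
    [set v | sa_func a v /\ nrm v <= rho] kappa rho.
- by split; [exact: sa_func0 | rewrite nrm0].
- move=> v [av vrho]; split.
    by apply/sa_funcZ/sa_funcD; [exact: sa_func_id | apply/PS/sa_funcM].
  apply: le_trans (Tn _ _ vrho) _; rewrite -(ler_pMn2r (n := 2))//.
  by rewrite mulr2n -mulrDl h2 mul1r.
- move=> u l uS ul; split; first by apply: (sa_func_lim _ ul) => n; case: (uS n).
  by apply: (tends_nrm_le ul); exists 0%N => n _; case: (uS n).
- move=> u l ul; apply/tendsZ/tendsD; first exact: tends_cst.
  by apply: (tends_dom (C := 1) (tendsM ul ul)) => n; rewrite -PB mul1r.
- elim=> [|n IH].
    by rewrite /= subr0 (le_trans (Tn 0 0 _)) ?nrm0//= subr0.
  rewrite iterS [iter n.+1 T 0 in X in _ - X]iterS.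
  apply: le_trans (TB _ _) _.
  (* The scalar increments factor exactly as in the estimate [TB], so the majorization
     propagates. *)
  have -> : kappa n.+2 - kappa n.+1 =
      half * (kappa n.+1 + kappa n) * (kappa n.+1 - kappa n).
    by rewrite (kS n.+1) [in X in _ - X = _](kS n); ring.
  apply: ler_pM => //; first by rewrite mulr_ge0// addr_ge0// nrm_ge0.
  - exact: nrm_ge0.
  - by rewrite ler_wpM2l// lerD.
- exact: krho.
exists v => //; rewrite mulr2n -{1 2}vE /T -scalerDl -rmorphD h2.
by rewrite scale1r.
Qed.

End Iteration.

(** * Selfadjoint elements and contractivity of morphisms *)

Section SelfAdjoint.
Variables (R : realType) (A : cstarAlgType R).
Implicit Types (a b c e f g x y z : A).

Lemma star_cmul_sa x : star (star x *c x) = star x *c x.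
Proof. by rewrite starM starK. Qed.

Lemma nrm_sa_sqr a : star a = a -> nrm (a *c a) = nrm a ^+ 2.
Proof. by move=> sa; rewrite -nrm_cstar sa. Qed.

(* Both f + ig and f - ig have square norm |f*f + g*g|. *)
Lemma nrm_le_sum_sqr f g : star f *c g = star g *c f ->
  nrm f ^+ 2 <= nrm (star f *c f + star g *c g) /\
  nrm g ^+ 2 <= nrm (star f *c f + star g *c g).
Proof.
move=> fg; set N := nrm (_ + _).
pose w1 := f + 'i *: g; pose w2 := f - 'i *: g.
have ii x : 'i *: ('i *: x) = - x by rewrite scalerA -expr2 sqr_i scaleN1r.
have n1 : nrm w1 ^+ 2 = N.
  by rewrite -nrm_cstar /w1 starD starZi !cmulE ii fg; congr nrm; lmod.
have n2 : nrm w2 ^+ 2 = N.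
  rewrite -nrm_cstar /w2 starD starN starZi opprK !cmulE ii fg; congr nrm.
  by lmod.
have n12 : nrm w2 = nrm w1.
  by apply/eqP; rewrite -(eqrXn2 (n := 2)) ?nrm_ge0// n1 n2.
rewrite -n1; split; apply: lerXn2r; rewrite ?nnegrE ?nrm_ge0// -(ler_pMn2r (n := 2))//.
  rewrite -nrmMn (_ : f *+ 2 = w1 + w2); last by rewrite /w1 /w2; lmod.
  by rewrite (le_trans (nrmD _ _))// n12 mulr2n.
rewrite -nrmMn -nrmZi (_ : 'i *: (g *+ 2) = w1 - w2); last first.
  by rewrite /w1 /w2; lmod.
by rewrite (le_trans (nrmB _ _))// n12 mulr2n.
Qed.

(* The hypothesis says b^2 + (1 - e)^2 = 1. *)
Lemma sqr_sum1_contr b e : star b = b -> star e = e -> b *c e = e *c b ->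
  e + e - e *c e = b *c b ->
  forall y, nrm (b *c y) <= nrm y /\ nrm (y - e *c y) <= nrm y.
Proof.
move=> sb se be eb y; have [|Hf Hg] := @nrm_le_sum_sqr (b *c y) (y - e *c y).
  rewrite starD starN !starM sb se !cmulE -!cmulA.
  by rewrite !(cmulA b) !(cmulA e) be; lmod.
have E : star (b *c y) *c (b *c y) + star (y - e *c y) *c (y - e *c y) =
    star y *c y.
  rewrite starD starN !starM sb se !cmulE -!cmulA !(cmulA b) -eb !cmulE -!cmulA.
  by lmod.
rewrite E nrm_cstar in Hf Hg.
by split; rewrite -(ler_pXn2r (n := 2)) ?nnegrE ?nrm_ge0.
Qed.

Lemma nrm_le1_of_contr b : (forall y, nrm (b *c y) <= nrm y) ->
  star b = b -> nrm b <= 1.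
Proof.
move=> bc sb; have [b0|b0] := ltP 0 (nrm b); last exact: le_trans b0 ler01.
by have := bc b; rewrite nrm_sa_sqr// expr2 ger_pMr.
Qed.

(* k = 1 - sqrt (1 - a) *)
Lemma one_sub_sqrt a (r rho : R) : 0 <= rho -> nrm a <= r ->
  r + rho ^+ 2 <= rho *+ 2 -> star a = a ->
  exists2 k, sa_func a k /\ nrm k <= rho & k + k - k *c k = a.
Proof.
move=> rho0 ar rrho sa.
have [//|//|//|v vS vE] := @quadratic_fix _ _ a id r rho rho0 ar rrho sa.
by exists v => //; rewrite -mulr2n vE addrK.
Qed.

Lemma one_sub_sqrt1 a : nrm a <= 1 -> star a = a ->
  exists2 k, sa_func a k /\ nrm k <= 1 & k + k - k *c k = a.
Proof.
by move=> a1 sa; apply: (@one_sub_sqrt a 1 1) => //; rewrite expr1n.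
Qed.

(** Here 1/2 + (1/2)^2 is at most 2 * 1/2. The bound on [k] stays strictly below 1, so that 1 - k
    can be cancelled. *)
Lemma one_sub_sqrt_half a : nrm a <= 2^-1 -> star a = a ->
  exists2 k, sa_func a k /\ nrm k <= 2^-1 & k + k - k *c k = a.
Proof.
move=> a1 sa; apply: (@one_sub_sqrt a 2^-1 2^-1) => //.
by rewrite expr2; lra.
Qed.

(** With 1 - k = sqrt (1 - c^2) one has c^2 + (1 - k)^2 = 1, so 1 - k is a contraction, and 1 - c^2
    is its square. *)
Lemma one_sub_sqr_contr c y : star c = c -> nrm c <= 1 ->
  nrm (y - c *c c *c y) <= nrm y.
Proof.
move=> sc c1; have scc : star (c *c c) = c *c c by rewrite starM sc.
have [|//|k [[sk ck] k1] kE] := @one_sub_sqrt1 (c *c c).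
  by rewrite (le_trans (nrmM _ _))// -expr2 expr_le1// nrm_ge0.
have kc := ck c (esym (cmulA c c c)).
have W := sqr_sum1_contr sc sk (esym kc) kE.
have -> : y - c *c c *c y = (y - k *c y) - k *c (y - k *c y).
  by rewrite -kE !cmulE -!cmulA; lmod.
by apply: le_trans (proj2 (W _)) (proj2 (W _)).
Qed.

(** A norm formulation of the positivity of c^2. The scale is [nrm c + 1] so that dividing by it is
    possible even for c = 0. *)
Lemma shift_sub_sqr_contr c y : star c = c ->
  nrm (((nrm c + 1) ^+ 2)%:C *: y - c *c c *c y) <= (nrm c + 1) ^+ 2 * nrm y.
Proof.
move=> sc; set t := nrm c + 1; have t0 : 0 < t by rewrite ltr_wpDl ?nrm_ge0.
pose h := t^-1%:C *: c; have hE : c = t%:C *: h.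
  by rewrite scalerA -rmorphM mulfV ?gt_eqF// scale1r.
have sh : star h = h by rewrite starZr sc.
have h1 : nrm h <= 1.
  by rewrite nrmZr gtr0_norm ?invr_gt0// mulrC ler_pdivrMr// mul1r lerDl.
clearbody h; rewrite hE !cmulE (_ : _ - _ = (t ^+ 2)%:C *: (y - h *c h *c y)); last first.
  by rewrite expr2 rmorphM/=; lmod.
by rewrite nrmZr ger0_norm ?sqr_ge0// ler_wpM2l ?sqr_ge0// one_sub_sqr_contr.
Qed.

(** If c^2 x = - x, then (t^2 - c^2) x = (t^2 + 1) x, which exceeds the bound t^2 |x| unless x =
    0. *)
Lemma add_sqr_inj c x : star c = c -> x + c *c c *c x = 0 -> x = 0.
Proof.
move=> sc cx; have := shift_sub_sqr_contr x sc; set t2 := (_ ^+ 2 : R).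
have -> : t2%:C *: x - c *c c *c x = (t2 + 1)%:C *: x.
  have -> : c *c c *c x = - x by apply/eqP; rewrite -addr_eq0 addrC cx.
  by rewrite rmorphD rmorph1/=; lmod.
rewrite nrmZr ger0_norm ?addr_ge0 ?sqr_ge0// mulrDl mul1r gerDl.
exact: nrm_eq0.
Qed.

(* v = 2c / (1 + c^2) *)
Lemma cayley_exists c : star c = c ->
  exists2 v, sa_func c v & v + c *c c *c v = c + c.
Proof.
move=> sc; set t2 := ((nrm c + 1) ^+ 2 : R).
have t20 : 0 <= t2 by rewrite sqr_ge0.
have t21 : 0 < 1 + t2 by rewrite ltr_pwDl.
pose s : R := (1 + t2)^-1; have s0 : 0 < s by rewrite invr_gt0.
(* The equation (1 + c^2) v = 2c is rewritten as (1 + t^2) v = (t^2 - c^2) v + 2c, with contraction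
   ratio t^2 / (1 + t^2). *)
pose T v := s%:C *: (t2%:C *: v - c *c c *c v + (c + c)).
have [|||||v Sv vE] := @contraction_fix _ _ T (sa_func c) (s * t2).
- by rewrite mulr_ge0 ?(ltW s0)//= mulrC ltr_pdivrMr// mul1r ltrDr.
- move=> v w; rewrite (_ : T v - T w =
      s%:C *: (t2%:C *: (v - w) - c *c c *c (v - w))); last first.
    by rewrite /T !cmulE; lmod.
  by rewrite nrmZr gtr0_norm// -mulrA ler_pM2l// shift_sub_sqr_contr.
- exact: sa_func0.
- move=> v Sv; have Sc : sa_func c c by [].
  apply/sa_funcZ/sa_funcD; last exact: sa_funcD.
  by apply: sa_funcD; [exact: sa_funcZ | apply/sa_funcN/sa_funcM => //; exact: sa_funcM].
- by move=> u l; exact: sa_func_lim.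
exists v => //; have : (1 + t2)%:C *: T v = (1 + t2)%:C *: v by rewrite vE.
rewrite /T scalerA -rmorphM mulfV ?gt_eqF// scale1r rmorphD rmorph1/= => E.
apply/eqP; rewrite -subr_eq0; apply/eqP.
have -> : v + c *c c *c v - (c + c) =
    (1 + t2%:C) *: v - (t2%:C *: v - c *c c *c v + (c + c)) by lmod.
by rewrite E subrr.
Qed.

(* e = c v = 2c^2 / (1 + c^2) *)
Lemma cayley_contr c v : star c = c -> sa_func c v -> v + c *c c *c v = c + c ->
  nrm v <= 1 /\ nrm (c *c v) <= 2.
Proof.
move=> sc Sv vE; have Sc : sa_func c c by [].
have [se _] := sa_funcM Sc Sv; have [sv _] := Sv.
have vc := sa_func_comm Sv Sc.
(* [v] = 2c / (1 + c^2) and 1 - e = (1 - c^2) / (1 + c^2) are the sine and cosine in the Cayley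
   parametrization, so their squares sum to 1. *)
have W : forall y, nrm (v *c y) <= nrm y /\ nrm (y - c *c v *c y) <= nrm y.
  apply: sqr_sum1_contr => //; first by rewrite cmulA vc.
  have : v *c (v + c *c c *c v) = v *c (c + c) by rewrite vE.
  rewrite !cmulE vc => /(canRL (addrK _)) ->; congr (_ - _).
  by rewrite !cmulA vc -(cmulA c v c) vc !cmulA.
split; first by apply: nrm_le1_of_contr => // y; case: (W y).
have [b0|b0] := ltP 0 (nrm (c *c v)); last exact: le_trans b0 _.
rewrite -(ler_pM2r b0) -expr2 -nrm_sa_sqr//.
set e := c *c v in W se b0 *.
(* As 1 - e is a contraction, this splitting bounds |e|^2 by 2 |e|. *)
rewrite (_ : e *c e = e - (e - e *c e)); last by lmod.
rewrite (le_trans (nrmB _ _))// mulr2n mulrDl mul1r lerD2l.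
by case: (W e).
Qed.

End SelfAdjoint.

(** * Contractivity of morphisms *)

Section StarHom.
Variables (R : realType) (A B : cstarAlgType R) (h : A ~*> B).
Implicit Types x y : A.

Lemma homZ (c : R[i]) x : h (c *: x) = c *: h x.
Proof.
have h0 : h 0 = 0.
  have := star_homP h (-1) 0 0.
  by rewrite scaler0 addr0 scaleN1r addNr.
by rewrite -[c *: x]addr0 star_homP h0 addr0.
Qed.

Lemma hom0 : h 0 = 0.
Proof. by rewrite -(scale0r (0 : A)) homZ scale0r. Qed.

Lemma homD x y : h (x + y) = h x + h y.
Proof. by rewrite -[x in LHS]scale1r star_homP scale1r. Qed.

Lemma homN x : h (- x) = - h x.
Proof. by rewrite -scaleN1r homZ scaleN1r. Qed.

Lemma homMn x n : h (x *+ n) = h x *+ n.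
Proof. by elim: n => [|n IH]; rewrite ?hom0// !mulrS homD IH. Qed.

Definition homE := (homD, homN, homZ, homMn, hom0, star_homM h, star_hom_star h).

(** For selfadjoint a with |a| at most 1, the bound is witnessed by the identity a^2 + (1 - k)^2 =
    1. A morphism preserves this identity, and the image then forces the same bound. *)
Lemma hom_contr x : nrm (h x) <= nrm x.
Proof.
suff sa1 a : star a = a -> nrm a <= 1 -> nrm (h a) <= 1.
  suff sa a : star a = a -> nrm (h a) <= nrm a.
    rewrite -(ler_pXn2r (n := 2)) ?nnegrE ?nrm_ge0// -!nrm_cstar.
    by rewrite -star_hom_star -star_homM sa// star_cmul_sa.
  move=> sa; have [a0|a0] := ltP 0 (nrm a); last first.
    by rewrite (nrm_eq0 a0) hom0 !nrm0.
  have := sa1 ((nrm a)^-1%:C *: a); rewrite starZr sa homZ !nrmZr.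
  rewrite gtr0_norm ?invr_gt0// mulVf ?gt_eqF// => /(_ erefl (lexx _)).
  by rewrite mulrC ler_pdivrMr// mul1r.
move=> sa a1; have [||k [[sk ak] _] kE] := @one_sub_sqrt1 _ _ (a *c a).
- by rewrite (le_trans (nrmM _ _))// -expr2 expr_le1// nrm_ge0.
- by rewrite starM sa.
have ka := ak a (esym (cmulA a a a)).
apply: nrm_le1_of_contr => [y|]; last by rewrite -star_hom_star sa.
apply: (proj1 (sqr_sum1_contr _ _ _ _ y)); last 1 first.
- by rewrite -!star_homM -kE !homE.
- by rewrite -star_hom_star sa.
- by rewrite -star_hom_star sk.
- by rewrite -!star_homM ka.
Qed.

Lemma hom_tends u l : tends u l -> tends (h \o u) (h l).
Proof.
by move=> ul; apply: (tends_dom (C := 1) ul) => n; rewrite /= -homN -homD mul1r hom_contr.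
Qed.

End StarHom.

(** * Lifting contractions *)

Section Lifting.
Variables (R : realType).
Implicit Types (A C Q : cstarAlgType R).

Lemma cmul_lt1_inj A (K x : A) (q : R) : nrm K <= q -> q < 1 ->
  x = x *c K \/ x = K *c x -> x = 0.
Proof.
move=> Kq q1 xK; apply: nrm_eq0; rewrite leNgt; apply/negP => x0.
suff : nrm x <= q * nrm x by rewrite ler_pMl// leNgt q1.
case: xK => {1}->; apply: le_trans (nrmM _ _) _; last by rewrite ler_pM2r.
by rewrite mulrC ler_pM2r.
Qed.

Lemma double_half A (x : A) : (2^-1 : R)%:C *: x + (2^-1 : R)%:C *: x = x.
Proof.
rewrite -scalerDl -rmorphD (_ : _ + _ = 1) ?rmorph1 ?scale1r//.
by lra.
Qed.

(* With f(n) = sqrt (2 / (1 + n^2)), any contraction is of the form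
   z f(z*z); moreover c f(c*c) is a contraction for every c. *)
Lemma contraction_decomp A (y : A) : nrm y <= 1 -> exists z n K : A,
  [/\ [/\ star n = n, n *c (star y *c y) = star y *c y *c n & star z *c z = n],
      star y *c y + n *c n *c (star y *c y) = n + n,
      nrm K <= 2^-1,
      sa_func ((2^-1 : R)%:C *: (n *c (star y *c y))) K /\
      K + K - K *c K = (2^-1 : R)%:C *: (n *c (star y *c y)) &
      y = (Num.sqrt 2 : R)%:C *: (z - z *c K)].
Proof.
move=> y1; set h := star y *c y; have sh : star h = h by exact: star_cmul_sa.
have h1 : nrm h <= 1 by rewrite nrm_cstar expr_le1// nrm_ge0.
have Sh : sa_func h h by [].
(* n = (1 - sqrt (1 - h^2)) / h, the root in [0, 1] of h = 2n / (1 + n^2), obtained without dividing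
   by h. *)
have [||v|v Sv|n [Sn n1] nE] := @quadratic_fix _ _ h (cmul h) 1 1 ler01 h1 _ sh.
- by rewrite expr1n.
- by move=> x z; rewrite cmulDr cmulxN.
- by rewrite (le_trans (nrmM _ _))// ler_piMl ?nrm_ge0.
- exact: sa_funcM.
have nh := sa_func_comm Sn Sh.
have {nE} nE : n + n = h + n *c n *c h.
  rewrite -mulr2n nE; congr (_ + _).
  exact: sa_func_comm Sh (sa_funcM Sn Sn).
pose a := (2^-1 : R)%:C *: (n *c h).
have sa : star a = a by case: (sa_funcZ 2^-1 (sa_funcM Sn Sh)).
have a2 : nrm a <= 2^-1.
  rewrite nrmZr ger0_norm ?invr_ge0// ger_pMr ?invr_gt0//.
  by rewrite (le_trans (nrmM _ _))// mulr_ile1 ?nrm_ge0.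
(* Since n h / 2 = n^2 / (1 + n^2), this makes 1 - K equal to 1 / sqrt (1 + n^2). *)
have [K [SK K2] KE] := one_sub_sqrt_half a2 sa.
have half1 : (2^-1 : R) < 1 by rewrite invf_lt1// ltr1n.
set s : R := Num.sqrt 2; have s0 : 0 < s by rewrite sqrtr_gt0.
have ss : s * s = 2 by rewrite -expr2 sqr_sqrtr.
(* z is y (1 - K)^-1 / sqrt 2; the inverse is a Neumann series, converging because |K| is at most
   1/2. *)
have [|||||z _ zE] := @contraction_fix _ _ (fun z => s^-1%:C *: y + z *c K) setT 2^-1.
- by rewrite invr_ge0 ler0n.
- move=> v w; have -> : s^-1%:C *: y + v *c K - (s^-1%:C *: y + w *c K) =
    (v - w) *c K by rewrite !cmulE; lmod.
  by rewrite (le_trans (nrmM _ _))// mulrC ler_wpM2r ?nrm_ge0.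
- by [].
- by [].
- by [].
have zy : z - z *c K = s^-1%:C *: y by rewrite -{1}zE; lmod.
have sK : star K = K by case: SK.
have nK : n *c K = K *c n.
  apply/esym; case: SK => _; apply; rewrite !cmulE; congr (_ *: _).
  by rewrite -cmulA nh.
exists z, n, K; split => //; last first.
- by rewrite zy scalerA -rmorphM mulfV ?gt_eqF// scale1r.
- split=> //; first by case: Sn.
pose x := star z *c z - n.
(* This says (1 - K) x (1 - K) = 0; both factors can be cancelled. It holds because z*z and n,
   flanked by 1 - K, both become h / 2. *)
suff x0 : (x - x *c K) - K *c (x - x *c K) = 0.
  have u0 : x - x *c K = 0.
    by apply: (cmul_lt1_inj K2 half1); right; apply/eqP; rewrite -subr_eq0 x0.
  apply/eqP; rewrite -subr_eq0; apply/eqP; apply: (cmul_lt1_inj K2 half1).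
  by left; apply/eqP; rewrite -subr_eq0 -/x u0.
have zz : star (z - z *c K) *c (z - z *c K) = (2^-1 : R)%:C *: h.
  rewrite zy starZr !cmulE scalerA -rmorphM -invfM ss; congr (_ *: _).
have nn : n - n *c (K + K - K *c K) = (2^-1 : R)%:C *: h.
  rewrite KE /a !cmulE cmulA -{1}(double_half n) -scalerDr nE.
  by lmod.
rewrite -[RHS](subrr ((2^-1 : R)%:C *: h)) -{1}zz -nn /x.
have nKK : n *c (K *c K) = K *c (K *c n) by rewrite cmulA nK -cmulA nK.
by rewrite starD starN starM sK !cmulE -!cmulA nKK nK; lmod.
Qed.

(** An uncontrolled lift c of z is corrected to sqrt 2 c (1 - k), with m = c*c and 1 - k = 1 / sqrt
    (1 + m^2). Its square modulus is v = 2m / (1 + m^2), of norm at most 1 by [cayley_contr]. *)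
Lemma lift_contraction C Q (p : C ~*> Q) (y : Q) :
  (forall q, exists c, p c = q) -> nrm y <= 1 ->
  exists2 c, nrm c <= 1 & p c = y.
Proof.
move=> psurj y1; have [z [n [K]]] := contraction_decomp y1.
set h := star y *c y => -[[sn nh zn] hE K2 [SK KE] yE].
have [c cz] := psurj z; have [m mE] : exists m, m = star c *c c by exists (star c *c c).
have sm : star m = m by rewrite mE star_cmul_sa.
have pm : p m = n by rewrite mE star_homM star_hom_star cz.
have [v Sv vE] := cayley_exists sm.
have [v1 e2] := cayley_contr sm Sv vE.
(* Both sides solve (1 + n^2) w = 2n, and 1 + n^2 is injective. *)
have pv : p v = h.
  apply/eqP; rewrite -subr_eq0; apply/eqP/(add_sqr_inj sn).
  have := congr1 p vE; rewrite !homE pm => pvE.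
  by rewrite -[RHS](subrr (n + n)) -{1}pvE -hE !cmulE; lmod.
pose a : C := (2^-1 : R)%:C *: (m *c v).
have Sm : sa_func m m by [].
have Sa : sa_func m a by apply/sa_funcZ/sa_funcM.
have [|k [Sk k1] kE] := @one_sub_sqrt1 _ _ a _ (proj1 Sa).
  by rewrite nrmZr ger0_norm ?invr_ge0// mulrC ler_pdivrMr// mul1r.
(* Both are roots w of the same equation 2w - w^2 = a, so (K - p k)(K + p k) = 2 (K - p k). From |K|
   at most 1/2 and |k| at most 1, the second factor has norm at most 3/2 < 2, which leaves K = p
   k. *)
have pk : p k = K.
  have pkE : p k + p k - p k *c p k = K + K - K *c K.
    by rewrite KE -pv -pm -!star_homM -homZ -/a -kE !homE.
  have kK : K *c p k = p k *c K.
    by case: SK => _; apply; rewrite -KE -pkE !cmulE cmulA.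
  apply/esym/eqP; rewrite -subr_eq0; apply/eqP/nrm_eq0; rewrite leNgt.
  apply/negP => d0.
  have : nrm ((K - p k) *+ 2) <= nrm (K - p k) * (2^-1 + 1).
    have -> : (K - p k) *+ 2 = (K - p k) *c (K + p k).
      apply/eqP; rewrite -subr_eq0 -[0](subrr (K + K - K *c K)) -{2}pkE.
      by apply/eqP; rewrite !cmulE kK; lmod.
    rewrite (le_trans (nrmM _ _))// ler_pM2l// (le_trans (nrmD _ _))// lerD//.
    by rewrite (le_trans (hom_contr _ _)).
  by rewrite nrmMn mulr2n; lra.
exists ((Num.sqrt 2 : R)%:C *: (c - c *c k)); last by rewrite !homE cz pk -yE.
rewrite -(ler_pXn2r (n := 2)) ?nnegrE ?nrm_ge0// expr1n -nrm_cstar.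
rewrite (_ : _ *c _ = v)//.
have [sk km] := sa_func_trans Sa Sk; move/(_ m erefl) in km.
rewrite starZr cmulZl cmulZr scalerA -rmorphM -expr2 sqr_sqrtr//.
have E : m *c (k + k - k *c k) = (2^-1 : R)%:C *: (m *c m *c v).
  by rewrite kE /a cmulZr cmulA.
have E' : m *c m *c v = m + m - v by rewrite -vE; lmod.
have -> : star (c - c *c k) *c (c - c *c k) = m - m *c (k + k - k *c k).
  have km' : k *c (star c *c c) = star c *c (c *c k) by rewrite -mE km mE cmulA.
  have km2 : k *c (star c *c (c *c k)) = star c *c (c *c (k *c k)).
    by rewrite (cmulA (star c)) cmulA -mE km -cmulA mE -!cmulA.
  by rewrite starD starN starM sk mE !cmulE -!cmulA km' km2; lmod.
rewrite E E' rmorph_nat scaler_nat mulr2n addrACA -opprD double_half.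
by lmod.
Qed.

End Lifting.

(** * Universal C*-algebras *)

(** Raw syntax, with no algebraic law imposed: terms are only ever compared through their
    evaluations, and [cseq_eq] later identifies what these cannot distinguish. *)
Inductive term (K X : Type) : Type :=
| Gen of X
| Zero
| Add of term K X & term K X
| Opp of term K X
| Scale of K & term K X
| Mul of term K X & term K X
| Star of term K X.
Arguments Zero {K X}.
Arguments Gen {K X}.

Fixpoint teval (R : realType) (X : Type) (D : cstarAlgType R) (y : X -> D)
    (t : term R[i] X) : D :=
  match t with
  | Gen x => y x
  | Zero => 0
  | Add t u => teval y t + teval y u
  | Opp t => - teval y t
  | Scale c t => c *: teval y t
  | Mul t u => teval y t *c teval y u
  | Star t => star (teval y t)
  end.

Lemma hom_teval (R : realType) (X : Type) (D E : cstarAlgType R) (h : D ~*> E)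
    (y : X -> D) t : h (teval y t) = teval (h \o y) t.
Proof.
by elim: t => [x||t IHt u IHu|t IHt|c t IHt|t IHt u IHu|t IHt] //=;
  rewrite !homE ?IHt ?IHu.
Qed.

(* [reps y] says that the family y of elements of a C*-algebra satisfies the
   relations; it is impredicative in the algebra, so that the universal
   seminorm is a supremum over a set of real numbers. *)
Record presentation (R : realType) := Presentation {
  gens : Type;
  reps : forall D : cstarAlgType R, (gens -> D) -> Prop;
  gen_bound : gens -> R;
  repsP : forall (D : cstarAlgType R) (y : gens -> D),
    reps y -> forall x, nrm (y x) <= gen_bound x
}.

Section Universal.
Variables (R : realType) (P : presentation R).
Local Notation X := (gens P).
Local Notation T := (term R[i] X).

Fixpoint term_bound (t : T) : R :=
  match t with
  | Gen x => gen_bound x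
  | Zero => 0
  | Add t u => term_bound t + term_bound u
  | Opp t => term_bound t
  | Scale c t => Normc.normc c * term_bound t
  | Mul t u => `|term_bound t| * term_bound u
  | Star t => term_bound t
  end.

Lemma normc_ge0 (c : R[i]) : 0 <= Normc.normc c.
Proof. by case: c => a b /=; rewrite sqrtr_ge0. Qed.

Lemma teval_bound (D : cstarAlgType R) (y : X -> D) t :
  reps y -> nrm (teval y t) <= term_bound t.
Proof.
move=> yP; elim: t => [x||t IHt u IHu|t IHt|c t IHt|t IHt u IHu|t IHt] /=.
- exact: repsP.
- by rewrite nrm0.
- by rewrite (le_trans (nrmD _ _))// lerD.
- by rewrite nrmN.
- by rewrite nrmZ ler_wpM2l// normc_ge0.
- rewrite (le_trans (nrmM _ _))// ler_pM ?nrm_ge0//.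
  exact: le_trans (ler_norm _).
- by rewrite nrm_star.
Qed.

(** The Cauchy condition for the universal seminorm, phrased before that seminorm exists. Quotient
    and completion are thus taken in one step. *)
Definition unif_cauchy (s : nat -> T) := forall e : R, 0 < e ->
  exists N, forall m n, (N <= m)%N -> (N <= n)%N ->
  forall (D : cstarAlgType R) (y : X -> D), reps y ->
  nrm (teval y (s m) - teval y (s n)) <= e.

Record cseq := CSeq { cseq_fun :> nat -> T; cseqP : unif_cauchy cseq_fun }.

HB.instance Definition _ := gen_eqMixin cseq.
HB.instance Definition _ := gen_choiceMixin cseq.

Definition leval (D : cstarAlgType R) (y : X -> D) (s : cseq) : D :=
  xget 0 [set l | tends (fun n => teval y (s n)) l].

Lemma levalP (D : cstarAlgType R) (y : X -> D) (s : cseq) : reps y ->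
  tends (fun n => teval y (s n)) (leval y s).
Proof.
move=> yP; have [|l sl] := @nrm_complete _ D (fun n => teval y (s n)).
  move=> e e0; have [|N sN] := @cseqP s (e / 2); first by rewrite divr_gt0.
  exists N => m n Nm Nn; apply: le_lt_trans (sN _ _ Nm Nn _ _ yP) _.
  by rewrite ltr_pdivrMr// ltr_pMr// ltr1n.
exact: (@xgetPex _ 0 [set l | tends (fun n => teval y (s n)) l] (ex_intro _ l sl)).
Qed.

Lemma leval_eq (D : cstarAlgType R) (y : X -> D) (s : cseq) l : reps y ->
  tends (fun n => teval y (s n)) l -> leval y s = l.
Proof. by move=> yP; apply: tends_uniq; exact: levalP. Qed.

Lemma leval_near (s : cseq) (e : R) : 0 < e -> exists N, forall n, (N <= n)%N ->
  forall (D : cstarAlgType R) (y : X -> D), reps y ->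
  nrm (leval y s - teval y (s n)) <= e.
Proof.
move=> e0; have [N sN] := cseqP s e0; exists N => n Nn D y yP.
apply: (tends_nrm_le (u := fun m => teval y (s m) - teval y (s n))).
  by apply: tendsD; [exact: levalP | exact: tends_cst].
by exists N => m Nm; exact: sN.
Qed.

Lemma unif_bounded (s : nat -> T) : unif_cauchy s -> exists N (M : R),
  forall n, (N <= n)%N -> forall (D : cstarAlgType R) (y : X -> D), reps y ->
  nrm (teval y (s n)) <= M.
Proof.
move=> /(_ 1 ltr01)[N sN]; exists N, (1 + term_bound (s N)) => n Nn D y yP.
rewrite -(subrK (teval y (s N)) (teval y (s n))) (le_trans (nrmD _ _))//.
by rewrite lerD// ?sN// teval_bound.
Qed.

Lemma unif_cauchy_cst t : unif_cauchy (fun=> t).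
Proof. by move=> e e0; exists 0%N => *; rewrite subrr nrm0 ltW. Qed.

Lemma unif_cauchy_dom (s s' : nat -> T) (C : R) : unif_cauchy s ->
  (forall m n (D : cstarAlgType R) (y : X -> D), reps y ->
    nrm (teval y (s' m) - teval y (s' n)) <=
    C * nrm (teval y (s m) - teval y (s n))) -> unif_cauchy s'.
Proof.
move=> sc ss' e e0; have C0 : 0 < `|C| + 1 by rewrite ltr_pwDr.
have [|N sN] := sc (e / (`|C| + 1)); first by rewrite divr_gt0.
exists N => m n Nm Nn D y yP; apply: le_trans (ss' _ _ _ _ yP) _.
have := sN _ _ Nm Nn _ _ yP; rewrite ler_pdivlMr//; apply: le_trans.
rewrite mulrC ler_wpM2l ?nrm_ge0//.
by rewrite (le_trans (ler_norm _))// lerDl.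
Qed.

Lemma unif_cauchy_add (s s' : nat -> T) : unif_cauchy s -> unif_cauchy s' ->
  unif_cauchy (fun n => Add (s n) (s' n)).
Proof.
move=> sc sc' e e0; have e20 : 0 < e / 2 by rewrite divr_gt0.
have [N sN] := sc _ e20; have [N' sN'] := sc' _ e20.
exists (maxn N N') => m n; rewrite !geq_max => /andP[? ?] /andP[? ?] D y yP /=.
rewrite opprD addrACA (le_trans (nrmD _ _))// (splitr e).
by rewrite lerD ?sN ?sN'.
Qed.

Lemma unif_cauchy_mul (s s' : nat -> T) : unif_cauchy s -> unif_cauchy s' ->
  unif_cauchy (fun n => Mul (s n) (s' n)).
Proof.
move=> sc sc' e e0; have e20 : 0 < e / 2 by rewrite divr_gt0.
have [N1 [M sM]] := unif_bounded sc; have [N1' [M' sM']] := unif_bounded sc'.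
have C0 : 0 < `|M| + 1 by rewrite ltr_pwDr.
have C0' : 0 < `|M'| + 1 by rewrite ltr_pwDr.
have [|N sN] := sc (e / 2 / (`|M'| + 1)); first by rewrite divr_gt0.
have [|N' sN'] := sc' (e / 2 / (`|M| + 1)); first by rewrite divr_gt0.
exists (maxn (maxn N N') (maxn N1 N1')) => m n; rewrite !geq_max.
move=> /andP[/andP[Nm Nm'] /andP[N1m N1m']] /andP[/andP[Nn Nn'] /andP[N1n N1n']].
move=> D y yP /=.
rewrite (_ : _ - _ = teval y (s m) *c (teval y (s' m) - teval y (s' n)) +
  (teval y (s m) - teval y (s n)) *c teval y (s' n)); last by rewrite !cmulE; lmod.
rewrite (le_trans (nrmD _ _))// (splitr e) lerD//.
  apply: le_trans (nrmM _ _) _.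
  have := sN' _ _ Nm' Nn' _ _ yP; rewrite ler_pdivlMr// mulrC; apply: le_trans.
  rewrite ler_wpM2r ?nrm_ge0// (le_trans (sM _ N1m _ _ yP))//.
  by rewrite (le_trans (ler_norm _))// lerDl.
apply: le_trans (nrmM _ _) _.
have := sN _ _ Nm Nn _ _ yP; rewrite ler_pdivlMr//; apply: le_trans.
rewrite ler_wpM2l ?nrm_ge0// (le_trans (sM' _ N1n' _ _ yP))//.
by rewrite (le_trans (ler_norm _))// lerDl.
Qed.

Lemma unif_cauchy_opp (s : nat -> T) : unif_cauchy s ->
  unif_cauchy (fun n => Opp (s n)).
Proof.
move=> sc; apply: (unif_cauchy_dom (C := 1) sc) => m n D y yP /=.
by rewrite -opprD nrmN mul1r.
Qed.

Lemma unif_cauchy_scale c (s : nat -> T) : unif_cauchy s ->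
  unif_cauchy (fun n => Scale c (s n)).
Proof.
move=> sc; apply: (unif_cauchy_dom (C := Normc.normc c) sc) => m n D y yP /=.
by rewrite -scalerBr nrmZ.
Qed.

Lemma unif_cauchy_star (s : nat -> T) : unif_cauchy s ->
  unif_cauchy (fun n => Star (s n)).
Proof.
move=> sc; apply: (unif_cauchy_dom (C := 1) sc) => m n D y yP /=.
by rewrite -starN -starD nrm_star mul1r.
Qed.

Definition cseq_eq (s s' : cseq) : bool :=
  `[< forall (D : cstarAlgType R) (y : X -> D), reps y -> leval y s = leval y s' >].

Fact cseq_eq_refl : reflexive cseq_eq.
Proof. by move=> s; apply/asboolP. Qed.

Fact cseq_eq_sym : symmetric cseq_eq.
Proof. by move=> s s'; apply/asboolP/asboolP => ss' D y /ss'. Qed.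

Fact cseq_eq_trans : transitive cseq_eq.
Proof.
by move=> s' s s'' /asboolP ss' /asboolP ss''; apply/asboolP => D y yP;
  rewrite ss'// ss''.
Qed.

Canonical cseq_equiv := EquivRel cseq_eq cseq_eq_refl cseq_eq_sym cseq_eq_trans.

Definition univ : Type := {eq_quot cseq_equiv}.

Definition uclass (s : cseq) : univ := \pi_({eq_quot cseq_equiv}) s.
Definition urepr (u : univ) : cseq := repr (u : {eq_quot cseq_equiv}).
Definition ueval (D : cstarAlgType R) (y : X -> D) (u : univ) : D := leval y (urepr u).

Lemma uevalE (D : cstarAlgType R) (y : X -> D) s : reps y ->
  ueval y (uclass s) = leval y s.
Proof.
move=> yP; have /eqmodP/asboolP : \pi_({eq_quot cseq_equiv}) (urepr (uclass s)) =
  \pi_({eq_quot cseq_equiv}) s by rewrite reprK.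
exact.
Qed.

(** Evaluations separate points, so each algebraic law of [univ] is inherited from the algebras in
    which it is evaluated. *)
Lemma univ_ext (u v : univ) : (forall (D : cstarAlgType R) (y : X -> D), reps y ->
  ueval y u = ueval y v) -> u = v.
Proof.
move=> uv; rewrite -[u]reprK -[v]reprK; apply/eqmodP/asboolP => D y yP.
exact: uv.
Qed.

Definition uterm (t : T) : univ := uclass (CSeq (unif_cauchy_cst t)).
Definition uadd (u v : univ) : univ :=
  uclass (CSeq (unif_cauchy_add (cseqP (urepr u)) (cseqP (urepr v)))).
Definition uopp (u : univ) : univ :=
  uclass (CSeq (unif_cauchy_opp (cseqP (urepr u)))).
Definition uscale (c : R[i]) (u : univ) : univ :=
  uclass (CSeq (unif_cauchy_scale c (cseqP (urepr u)))).
Definition umul (u v : univ) : univ :=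
  uclass (CSeq (unif_cauchy_mul (cseqP (urepr u)) (cseqP (urepr v)))).
Definition ustar (u : univ) : univ :=
  uclass (CSeq (unif_cauchy_star (cseqP (urepr u)))).

Section Evaluation.
Variables (D : cstarAlgType R) (y : X -> D) (yP : reps y).

Lemma ueval_term t : ueval y (uterm t) = teval y t.
Proof. by rewrite uevalE//; apply: leval_eq => //; exact: tends_cst. Qed.

Lemma ueval_add u v : ueval y (uadd u v) = ueval y u + ueval y v.
Proof. by rewrite uevalE//; apply: leval_eq => //; apply: tendsD; exact: levalP. Qed.

Lemma ueval_opp u : ueval y (uopp u) = - ueval y u.
Proof.
rewrite uevalE//; apply: leval_eq => //.
by apply: (tends_dom (C := 1) (levalP (urepr u) yP)) => n /=; rewrite -opprD nrmN mul1r.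
Qed.

Lemma ueval_scale c u : ueval y (uscale c u) = c *: ueval y u.
Proof. by rewrite uevalE//; apply: leval_eq => //; apply: tendsZ; exact: levalP. Qed.

Lemma ueval_mul u v : ueval y (umul u v) = ueval y u *c ueval y v.
Proof. by rewrite uevalE//; apply: leval_eq => //; apply: tendsM; exact: levalP. Qed.

Lemma ueval_star u : ueval y (ustar u) = star (ueval y u).
Proof. by rewrite uevalE//; apply: leval_eq => //; apply: tends_star; exact: levalP. Qed.

End Evaluation.

Lemma univ_addA : associative uadd.
Proof. by move=> u v w; apply: univ_ext => D y yP; rewrite !ueval_add// addrA. Qed.

Lemma univ_addC : commutative uadd.
Proof. by move=> u v; apply: univ_ext => D y yP; rewrite !ueval_add// addrC. Qed.

Lemma univ_add0 : left_id (uterm Zero) uadd.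
Proof.
by move=> u; apply: univ_ext => D y yP; rewrite ueval_add// ueval_term// add0r.
Qed.

Lemma univ_addN : left_inverse (uterm Zero) uopp uadd.
Proof.
move=> u; apply: univ_ext => D y yP.
by rewrite ueval_add// ueval_opp// ueval_term// addNr.
Qed.

HB.instance Definition _ := gen_eqMixin univ.
HB.instance Definition _ := gen_choiceMixin univ.
HB.instance Definition _ := GRing.isZmodule.Build univ
  univ_addA univ_addC univ_add0 univ_addN.

Lemma univ_scaleA (a b : R[i]) u : uscale a (uscale b u) = uscale (a * b) u.
Proof. by apply: univ_ext => D y yP; rewrite !ueval_scale// scalerA. Qed.

Lemma univ_scale1 : left_id 1 uscale.
Proof. by move=> u; apply: univ_ext => D y yP; rewrite ueval_scale// scale1r. Qed.

Lemma univ_scaleDr : right_distributive uscale +%R.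
Proof.
move=> a u v; apply: univ_ext => D y yP.
by rewrite ueval_scale// !ueval_add// !ueval_scale// scalerDr.
Qed.

Lemma univ_scaleDl u : {morph uscale^~ u : a b / a + b}.
Proof.
move=> a b; apply: univ_ext => D y yP.
by rewrite ueval_scale// ueval_add// !ueval_scale// scalerDl.
Qed.

HB.instance Definition _ := GRing.Zmodule_isLmodule.Build R[i] univ
  univ_scaleA univ_scale1 univ_scaleDr univ_scaleDl.

End Universal.

(** * The universal norm and its completeness *)

Section UniversalNorm.
Variables (R : realType) (P : presentation R).
Local Notation X := (gens P).
Local Notation T := (term R[i] X).
Local Notation U := (univ P).
Implicit Types u v : U.

(** Including 0 keeps the set nonempty when the relations have no representation. *)
Definition rep_norms u : set R := [set r | r = 0 \/
  exists (D : cstarAlgType R) (y : X -> D), reps y /\ r = nrm (ueval y u)].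

Definition unorm u : R := sup (rep_norms u).

Lemma rep_norms_sup u : has_sup (rep_norms u).
Proof.
split; first by exists 0; left.
have [N [M uM]] := unif_bounded (cseqP (urepr u)).
exists `|M| => _ [->|[D [y [yP ->]]]]; first exact: normr_ge0.
apply: le_trans (ler_norm M); apply: (tends_nrm_le (levalP (urepr u) yP)).
by exists N => n Nn; exact: uM.
Qed.

Lemma unorm_ge0 u : 0 <= unorm u.
Proof. by apply: ub_le_sup; [case: (rep_norms_sup u) | left]. Qed.

Lemma ueval_le_unorm (D : cstarAlgType R) (y : X -> D) u : reps y ->
  nrm (ueval y u) <= unorm u.
Proof.
move=> yP; apply: ub_le_sup; first by case: (rep_norms_sup u).
by right; exists D, y.
Qed.

Lemma unorm_le u (C : R) : 0 <= C ->
  (forall (D : cstarAlgType R) (y : X -> D), reps y -> nrm (ueval y u) <= C) ->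
  unorm u <= C.
Proof.
move=> C0 uC; apply: ge_sup; first by case: (rep_norms_sup u).
by move=> _ [->//|[D [y [yP ->]]]]; exact: uC.
Qed.

Lemma unormD u v : unorm (u + v) <= unorm u + unorm v.
Proof.
apply: unorm_le => [|D y yP]; first by rewrite addr_ge0 ?unorm_ge0.
rewrite [u + v]/(uadd u v) ueval_add// (le_trans (nrmD _ _))//.
by rewrite lerD ?ueval_le_unorm.
Qed.

Lemma unormZ_le (c : R[i]) u : unorm (c *: u) <= Normc.normc c * unorm u.
Proof.
have c0 := normc_ge0 c; apply: unorm_le => [|D y yP].
  by rewrite mulr_ge0 ?unorm_ge0.
by rewrite [c *: u]/(uscale c u) ueval_scale// nrmZ ler_wpM2l// ueval_le_unorm.
Qed.

Lemma unormZ (c : R[i]) u : unorm (c *: u) = Normc.normc c * unorm u.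
Proof.
apply/eqP; rewrite eq_le unormZ_le /=; have [->|c0] := eqVneq c 0.
  by rewrite Normc.normc0 mul0r unorm_ge0.
rewrite -[u in leLHS](scalerK c0) -ler_pdivlMl; last first.
  by rewrite lt_def normc_ge0 andbT; apply: contra_neq c0; exact: Normc.eq0_normc.
by rewrite -Normc.normcV unormZ_le.
Qed.

Lemma unorm_eq0 u : unorm u = 0 -> u = 0.
Proof.
move=> u0; apply: univ_ext => D y yP.
have -> : ueval y (0 : U) = 0 by exact: (ueval_term yP Zero).
by apply: nrm_eq0; rewrite -u0 ueval_le_unorm.
Qed.

Let unormc u : R[i] := (unorm u)%:C.

Lemma univ_ler_normD u v : unormc (u + v) <= unormc u + unormc v.
Proof. by rewrite -rmorphD lecR unormD. Qed.

Lemma univ_normrZ (c : R[i]) u : unormc (c *: u) = `|c| * unormc u.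
Proof. by rewrite /unormc unormZ rmorphM; congr (_ * _). Qed.

Lemma univ_normr0_eq0 u : unormc u = 0 -> u = 0.
Proof. by move=> /(@complexI R); exact: unorm_eq0. Qed.

HB.instance Definition _ := Lmodule_isNormed.Build R[i] U
  univ_ler_normD univ_normrZ univ_normr0_eq0.

Lemma univ_normE u : `|u| = (unorm u)%:C.
Proof. by []. Qed.

Lemma ueval_dist (D : cstarAlgType R) (y : X -> D) u v : reps y ->
  nrm (ueval y u - ueval y v) <= unorm (u - v).
Proof.
move=> yP; apply: le_trans (ueval_le_unorm (u - v) yP).
by rewrite [u - v]/(uadd u (uopp v)) ueval_add// ueval_opp.
Qed.

Lemma unorm_dist_le u v (C : R) : 0 <= C ->
  (forall (D : cstarAlgType R) (y : X -> D), reps y ->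
    nrm (ueval y u - ueval y v) <= C) -> unorm (u - v) <= C.
Proof.
move=> C0 uv; apply: unorm_le => // D y yP.
by rewrite [u - v]/(uadd u (uopp v)) ueval_add// ueval_opp// uv.
Qed.

Lemma unorm_dist_term u (e : R) : 0 < e -> exists t, unorm (u - uterm t) <= e.
Proof.
move=> e0; have [N uN] := leval_near (urepr u) e0.
exists (urepr u N); apply: unorm_dist_le => [|D y yP]; first exact: ltW.
by rewrite ueval_term// uN.
Qed.

(** A diagonal argument: terms [t k] approximating points [a k] of ever smaller balls of the filter
    form a uniformly Cauchy sequence, whose class is the limit. *)
Lemma univ_complete (F : set_system U) : ProperFilter F -> cauchy F -> cvg F.
Proof.
move=> FF /cauchyP Fc.
have eps0 k : 0 < (k.+1%:R : R)^-1 by rewrite invr_gt0.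
have /choice[a aF] k : exists x, F (ball x ((k.+1%:R : R)^-1)%:C).
  by apply: Fc; rewrite ltcR.
have /choice[t tP] k : exists t, unorm (a k - uterm t) <= (k.+1%:R : R)^-1.
  exact: unorm_dist_term.
have aa m n : unorm (a m - a n) <= (m.+1%:R : R)^-1 + (n.+1%:R : R)^-1.
  have [x []] := filter_ex (filterI (aF m) (aF n)).
  rewrite -!ball_normE/= !univ_normE !ltcR => mx nx.
  rewrite -lecR rmorphD/= -univ_normE -(subrKA x).
  rewrite (le_trans (ler_normD _ _))// lerD//; first by rewrite univ_normE lecR ltW.
  by rewrite distrC univ_normE lecR ltW.
(* The factor 3 collects one error for [t m] against [a m] and two for [a m] against [a n]. The 6
   and the 4 below are 3 + 3 and 3 + 1. *)
have ta m n (D : cstarAlgType R) (y : X -> D) : reps y -> (n <= m)%N ->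
    nrm (teval y (t m) - ueval y (a n)) <= 3 * (n.+1%:R : R)^-1.
  move=> yP nm; apply: le_trans (nrm_distD (ueval y (a m)) _ _) _.
  have mn : (m.+1%:R : R)^-1 <= (n.+1%:R : R)^-1.
    by rewrite lef_pV2 ?posrE// ler_nat ltnS.
  have -> : 3 * (n.+1%:R : R)^-1 =
    (n.+1%:R)^-1 + ((n.+1%:R)^-1 + (n.+1%:R)^-1) by ring.
  rewrite lerD//.
    rewrite nrm_distC -(ueval_term yP) (le_trans (ueval_dist _ _ yP))//.
    exact: le_trans (tP m) mn.
  by rewrite (le_trans (ueval_dist _ _ yP))// (le_trans (aa _ _))// lerD.
have small (C e : R) : 0 < e -> 0 < C -> exists N, C * (N.+1%:R : R)^-1 <= e.
  move=> e0 C0; exists (Num.truncn (C / e)); rewrite ler_pdivrMr// mulrC -ler_pdivrMr//.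
  by rewrite ltW// truncnS_gt.
have tc : unif_cauchy t.
  move=> e e0; have [N Ne] := small 6 e e0 ltac:(by rewrite ltr0n).
  exists N => m n Nm Nn D y yP; apply: le_trans (nrm_distD (ueval y (a N)) _ _) _.
  apply: le_trans Ne; have -> : 6 * (N.+1%:R : R)^-1 =
    3 * (N.+1%:R)^-1 + 3 * (N.+1%:R)^-1 by ring.
  by rewrite lerD ?ta// nrm_distC ta.
pose l : U := uclass (CSeq tc).
have la n : unorm (l - a n) <= 3 * (n.+1%:R : R)^-1.
  apply: unorm_dist_le => [|D y yP]; first by rewrite mulr_ge0.
  rewrite uevalE//; apply: (@tends_nrm_le _ _ (fun m => teval y (t m) - ueval y (a n))).
    by apply: tendsD; [exact: (levalP (CSeq tc)) | exact: tends_cst].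
  by exists n => m nm; exact: ta.
apply/cvg_ex; exists l; apply/cvgrPdist_le => e e0.
have eE : (complex.Re e)%:C = e by rewrite RRe_real// gtr0_real.
have [||N Ne] := small 4 (complex.Re e) => //; first by rewrite -ltcR eE.
near=> x; have : ball (a N) ((N.+1%:R : R)^-1)%:C x by near: x; exact: aF.
rewrite -ball_normE/= univ_normE ltcR => /ltW xN.
rewrite -(subrKA (a N)) (le_trans (ler_normD _ _))// -eE !univ_normE -rmorphD lecR.
apply: le_trans Ne; have -> : 4 * (N.+1%:R : R)^-1 =
    3 * (N.+1%:R)^-1 + (N.+1%:R)^-1 by ring.
exact: lerD.
Unshelve. all: by end_near. Qed.

HB.instance Definition _ := Uniform_isComplete.Build U univ_complete.

Lemma univ_mulA : associative (@umul R P).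
Proof. by move=> u v w; apply: univ_ext => D y yP; rewrite !ueval_mul// cmulA. Qed.

Lemma univ_mulDl : left_distributive (@umul R P) +%R.
Proof.
by move=> u v w; apply: univ_ext => D y yP;
  rewrite ueval_mul// !ueval_add// !ueval_mul// cmulDl.
Qed.

Lemma univ_mulDr : right_distributive (@umul R P) +%R.
Proof.
by move=> u v w; apply: univ_ext => D y yP;
  rewrite ueval_mul// !ueval_add// !ueval_mul// cmulDr.
Qed.

Lemma univ_mulZl (c : R[i]) u v : umul (c *: u) v = c *: umul u v.
Proof.
by apply: univ_ext => D y yP; rewrite ueval_mul// !ueval_scale// ueval_mul// cmulZl.
Qed.

Lemma univ_mulZr (c : R[i]) u v : umul u (c *: v) = c *: umul u v.
Proof.
by apply: univ_ext => D y yP; rewrite ueval_mul// !ueval_scale// ueval_mul// cmulZr.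
Qed.

Lemma univ_starK : involutive (@ustar R P).
Proof. by move=> u; apply: univ_ext => D y yP; rewrite !ueval_star// starK. Qed.

Lemma univ_starD : {morph @ustar R P : u v / u + v}.
Proof.
by move=> u v; apply: univ_ext => D y yP;
  rewrite ueval_star// !ueval_add// !ueval_star// starD.
Qed.

Lemma univ_starZ (c : R[i]) u : ustar (c *: u) = Num.conj c *: ustar u.
Proof.
by apply: univ_ext => D y yP; rewrite ueval_star// !ueval_scale// ueval_star// starZ.
Qed.

Lemma univ_starM u v : ustar (umul u v) = umul (ustar v) (ustar u).
Proof.
by apply: univ_ext => D y yP; rewrite ueval_star// !ueval_mul// !ueval_star// starM.
Qed.

Lemma univ_normcM u v : `|umul u v| <= `|u| * `|v|.
Proof.
rewrite !univ_normE -rmorphM lecR; apply: unorm_le => [|D y yP].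
  by rewrite mulr_ge0 ?unorm_ge0.
rewrite ueval_mul// (le_trans (nrmM _ _))//.
by rewrite ler_pM ?nrm_ge0 ?ueval_le_unorm.
Qed.

Lemma univ_cstar_identity u : `|umul (ustar u) u| = `|u| ^+ 2.
Proof.
rewrite !univ_normE -rmorphXn; congr _%:C; apply/eqP; rewrite eq_le; apply/andP; split.
  apply: unorm_le => [|D y yP]; first by rewrite sqr_ge0.
  by rewrite ueval_mul// ueval_star// nrm_cstar lerXn2r ?nnegrE ?nrm_ge0 ?unorm_ge0 ?ueval_le_unorm.
rewrite -[leRHS]sqr_sqrtr ?unorm_ge0// lerXn2r ?nnegrE ?sqrtr_ge0 ?unorm_ge0//.
apply: unorm_le => [|D y yP]; first by rewrite sqrtr_ge0.
rewrite -(ler_pXn2r (n := 2)) ?nnegrE ?nrm_ge0 ?sqrtr_ge0// sqr_sqrtr ?unorm_ge0//.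
rewrite -nrm_cstar -ueval_star// -ueval_mul//; exact: ueval_le_unorm.
Qed.

HB.instance Definition _ := CompleteNormedModule_isCStarAlgebra.Build R U
  univ_mulA univ_mulDl univ_mulDr univ_mulZl univ_mulZr univ_starK univ_starD
  univ_starZ univ_starM univ_normcM univ_cstar_identity.

End UniversalNorm.

(** * The universal property *)

Section UniversalProperty.
Variables (R : realType) (P : presentation R).
Local Notation U := (univ P : cstarAlgType R).

Definition ugen (x : gens P) : U := uterm (Gen x).

Section Hom.
Variables (D : cstarAlgType R) (y : gens P -> D) (yP : reps y).

Fact ueval_linear : linear (ueval y : U -> D).
Proof. by move=> c u v; rewrite [LHS]ueval_add// ueval_scale. Qed.

Definition uhom : U ~*> D := @StarHom R U D (ueval y) ueval_linear
  (fun u v => ueval_mul yP u v) (fun u => ueval_star yP u).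

Lemma uhom_gen x : uhom (ugen x) = y x.
Proof. exact: ueval_term. Qed.

End Hom.

Lemma uterm_teval t : uterm t = teval ugen t.
Proof.
apply: univ_ext => D y yP; rewrite ueval_term// -[RHS]/(uhom yP _) hom_teval.
by congr teval; apply/funext => x; exact: (esym (uhom_gen yP x)).
Qed.

Lemma teval_dense (u : U) (e : R) : 0 < e -> exists t, nrm (u - teval ugen t) <= e.
Proof. by move=> /(unorm_dist_term u)[t ut]; exists t; rewrite -uterm_teval. Qed.

(** Morphisms are contractive, so agreement on the dense set of polynomials in the generators
    suffices. *)
Lemma hom_ext (D : cstarAlgType R) (h h' : U ~*> D) :
  (forall x, h (ugen x) = h' (ugen x)) -> h =1 h'.
Proof.
move=> hh' u; apply: nrm_le_eps => e e0.
have [|t ut] := teval_dense u (e := e / 3); first by rewrite divr_gt0.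
have ht : h (teval ugen t) = h' (teval ugen t).
  by rewrite !hom_teval; congr teval; exact/funext.
have -> : h u - h' u = h (u - teval ugen t) - h' (u - teval ugen t).
  by rewrite !homE ht; lmod.
apply: le_lt_trans (nrmB _ _) _.
apply: le_lt_trans (lerD (hom_contr _ _) (hom_contr _ _)) _.
by lra.
Qed.

(** Identities valid in every representation hold in [U] itself; this is how [fp_in] and [lim_in]
    are seen to be morphisms. *)
Lemma univ_hom_ext (u v : U) : (forall (D : cstarAlgType R) (h : U ~*> D),
  reps (h \o ugen) -> h u = h v) -> u = v.
Proof.
move=> uv; apply: univ_ext => D y yP; apply: (uv D (uhom yP)).
by rewrite (_ : _ \o _ = y)//; apply/funext => x; exact: uhom_gen.
Qed.

Lemma nrm_ugen x (C : R) : 0 <= C -> (forall (D : cstarAlgType R) (y : gens P -> D),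
  reps y -> nrm (y x) <= C) -> nrm (ugen x) <= C.
Proof. by move=> C0 xC; apply: unorm_le => // D y yP; rewrite ueval_term// xC. Qed.

End UniversalProperty.

(** * Free products with F_infty *)

Section HomTools.
Variables (R : realType).
Implicit Types A B C : cstarAlgType R.

Lemma norm_le1 A (x : A) : (`|x| <= 1) = (nrm x <= 1).
Proof. by rewrite normE -[1]/(1%:C) lecR. Qed.

Program Definition hom_comp A B C (g : B ~*> C) (f : A ~*> B) : A ~*> C :=
  @StarHom R A C (g \o f) _ _ _.
Next Obligation. by move=> A B C g f c x y /=; rewrite !homE. Qed.
Next Obligation. by move=> A B C g f x y /=; rewrite !homE. Qed.
Next Obligation. by move=> A B C g f x /=; rewrite !homE. Qed.

Program Definition hom_id A : A ~*> A := @StarHom R A A id _ _ _.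
Next Obligation. by []. Qed.
Next Obligation. by []. Qed.
Next Obligation. by []. Qed.

(** The residual is halved at each step, and the corrections sum to a preimage. Approximating the
    unit ball up to 1/2 is therefore enough, and no closed-range theorem enters. *)
Lemma half_dense_surj A B (h : A ~*> B) :
  (forall u, nrm u <= 1 -> exists2 x, nrm x <= 1 & nrm (u - h x) <= 2^-1) ->
  forall u, exists x, h x = u.
Proof.
move=> hd; have /choice[g gP] u :
    exists x, nrm x <= nrm u /\ nrm (u - h x) <= nrm u / 2.
  have [u0|u0] := ltP 0 (nrm u); last first.
    by exists 0; rewrite (nrm_eq0 u0) hom0 subr0 !nrm0 mul0r.
  have [|x x1 ux] := hd ((nrm u)^-1%:C *: u).
    by rewrite nrmZr gtr0_norm ?invr_gt0// mulVf ?gt_eqF.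
  exists ((nrm u)%:C *: x); rewrite nrmZr gtr0_norm// ger_pMr//; split=> //.
  rewrite -ler_pdivrMl// -[X in X * _]gtr0_norm ?invr_gt0// -nrmZr.
  rewrite scalerBr homZ scalerA -rmorphM mulVf ?gt_eqF//.
  by rewrite scale1r.
move=> u; pose r n := iter n (fun v => v - h (g v)) u.
pose c n := \sum_(i < n) g (r i).
have rn n : nrm (r n) <= nrm u * 2^-1 ^+ n.
  elim: n => [|n IH]; first by rewrite mulr1.
  by rewrite exprSr mulrA (le_trans (proj2 (gP _)))// ler_wpM2r ?invr_ge0.
have [||x cx] := @majorized_cvg _ _ c
    (fun n => nrm u * 2 * (1 - 2^-1 ^+ n)) (nrm u * 2).
- move=> n; have -> : c n.+1 - c n = g (r n).
    by rewrite /c big_ord_recr/= addrAC subrr add0r.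
  apply: le_trans (proj1 (gP _)) _; apply: le_trans (rn n) _.
  by rewrite exprS le_eqVlt; apply/orP; left; apply/eqP; field.
- move=> n; apply: ler_piMr; first by rewrite mulr_ge0 ?nrm_ge0.
  by rewrite gerBl exprn_ge0 ?invr_ge0.
exists x; apply: (tends_uniq (hom_tends h cx)).
have hc n : h (c n) = u - r n.
  elim: n => [|n IH]; first by rewrite /c big_ord0 hom0 subrr.
  by rewrite /c big_ord_recr/= homD -/(c n) IH -/(r n); lmod.
(* The crude bound n < 2^n turns the decay of the residual into an explicit index. *)
move=> e e0; exists (Num.truncn (nrm u / e)) => n Nn /=.
rewrite hc addrC addKr nrmN (le_lt_trans (rn n))//.
rewrite exprVn ltr_pdivrMr ?exprn_gt0// mulrC -ltr_pdivrMr//.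
apply: lt_le_trans (truncnS_gt _) _; rewrite -natrX ler_nat.
exact: leq_ltn_trans Nn (ltn_expl _ _).
Qed.

End HomTools.

Section Contractions.
Variable R : realType.

Definition contractions_pres : presentation R.
Proof.
refine (@Presentation R nat (fun D y => forall n, nrm (y n) <= 1) (fun=> 1) _).
by [].
Defined.

Definition Finfty : cstarAlgType R := univ contractions_pres.
Definition Fgen (n : nat) : Finfty := @ugen R contractions_pres n.

Lemma nrm_Fgen n : nrm (Fgen n) <= 1.
Proof. by apply: nrm_ugen => // D y yP; exact: yP. Qed.

Lemma Finfty_universal : is_universal_contractions Fgen.
Proof.
split=> [n|D y y1]; first by rewrite norm_le1 nrm_Fgen.
have yP : @reps R contractions_pres D y by move=> n; rewrite -norm_le1.
split; first by exists (uhom yP) => n; exact: uhom_gen.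
by move=> h h' hy h'y; apply: hom_ext => n; rewrite [LHS]hy -(h'y n).
Qed.

End Contractions.

Section FreeProduct.
Variables (R : realType) (A : cstarAlgType R).

(** Every element of A is a generator, and the relations require these generators to form a
    morphism. The free product thus comes from a single presentation; its universal property is
    [fp_free_product]. *)
Definition fp_pres : presentation R.
Proof.
refine (@Presentation R (A + nat)%type
  (fun D y => (exists f : A ~*> D, forall a, y (inl a) = f a) /\
              forall n, nrm (y (inr n)) <= 1)
  (fun g => if g is inl a then nrm a else 1) _).
by move=> D y [[f yf] y1] [a|n] //; rewrite yf hom_contr.
Defined.

Definition fp : cstarAlgType R := univ fp_pres.
Definition fp_gen (n : nat) : fp := @ugen R fp_pres (inr n).

Lemma nrm_fp_gen n : nrm (fp_gen n) <= 1.
Proof. by apply: nrm_ugen => // D y [_ y1]. Qed.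

Program Definition fp_in : A ~*> fp :=
  @StarHom R A fp (fun a => @ugen R fp_pres (inl a)) _ _ _.
Next Obligation.
move=> c a b; apply: univ_hom_ext => D h [[f hf] _].
by rewrite !homE [LHS]hf !homE -!hf.
Qed.
Next Obligation.
move=> a b; apply: univ_hom_ext => D h [[f hf] _].
by rewrite !homE [LHS]hf !homE -!hf.
Qed.
Next Obligation.
move=> a; apply: univ_hom_ext => D h [[f hf] _].
by rewrite !homE [LHS]hf !homE -!hf.
Qed.

Section Hom.
Variables (D : cstarAlgType R) (f : A ~*> D) (y : nat -> D).
Hypothesis y1 : forall n, nrm (y n) <= 1.

Definition fp_fun (g : gens fp_pres) : D :=
  match g with inl a => f a | inr n => y n end.

Fact fp_fun_reps : @reps R fp_pres D fp_fun.
Proof. by split=> //; exists f. Qed.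

Definition fp_hom : fp ~*> D := uhom fp_fun_reps.

Lemma fp_hom_in a : fp_hom (fp_in a) = f a.
Proof. exact: (uhom_gen fp_fun_reps (inl a)). Qed.

Lemma fp_hom_gen n : fp_hom (fp_gen n) = y n.
Proof. exact: (uhom_gen fp_fun_reps (inr n)). Qed.

End Hom.

Lemma fp_hom_ext (D : cstarAlgType R) (h h' : fp ~*> D) :
  (forall a, h (fp_in a) = h' (fp_in a)) ->
  (forall n, h (fp_gen n) = h' (fp_gen n)) -> h =1 h'.
Proof. by move=> ha hn; apply: hom_ext => -[a|n]; [exact: ha | exact: hn]. Qed.

Definition fp_inF : Finfty R ~*> fp :=
  @uhom R (contractions_pres R) fp fp_gen nrm_fp_gen.

Lemma fp_inF_gen n : fp_inF (Fgen R n) = fp_gen n.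
Proof. exact: (@uhom_gen R (contractions_pres R) fp fp_gen nrm_fp_gen n). Qed.

Lemma fp_free_product : is_free_product fp_in fp_inF.
Proof.
move=> D f g; have y1 n : nrm (g (Fgen R n)) <= 1.
  exact: le_trans (hom_contr _ _) (nrm_Fgen R n).
split; last first.
  move=> h h' hf hg h'f h'g; apply: fp_hom_ext => [a|n].
    by rewrite hf h'f.
  by rewrite -fp_inF_gen hg h'g.
exists (fp_hom f y1); split=> [a|b]; first exact: fp_hom_in.
have -> : fp_hom f y1 (fp_inF b) = hom_comp (fp_hom f y1) fp_inF b by [].
apply: hom_ext => n; rewrite -[LHS]/(fp_hom f y1 (fp_inF (Fgen R n))).
by rewrite fp_inF_gen fp_hom_gen.
Qed.

(** Given a lift on A, freeness leaves only the images of the x_n to be lifted, and they must stay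
    contractive. Projectivity and semiprojectivity both reduce to this. *)
Lemma fp_lift (D Q : cstarAlgType R) (p : D ~*> Q) (s : fp ~*> Q) (t : A ~*> D) :
  (forall q, exists c, p c = q) -> (forall a, p (t a) = s (fp_in a)) ->
  exists t' : fp ~*> D, forall b, p (t' b) = s b.
Proof.
move=> psurj pt; have /choice[y yP] n : exists c, nrm c <= 1 /\ p c = s (fp_gen n).
  have [|c c1 pc] := lift_contraction (y := s (fp_gen n)) psurj; last by exists c.
  exact: le_trans (hom_contr _ _) (nrm_fp_gen n).
have y1 n : nrm (y n) <= 1 by case: (yP n).
exists (fp_hom t y1) => b.
apply: (fp_hom_ext (h := hom_comp p (fp_hom t y1))) => [a|n].
  by rewrite -pt -(fp_hom_in t y1).
by case: (yP n) => _ <-; rewrite -(fp_hom_gen t y1).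
Qed.

Lemma fp_projective : projective A -> projective fp.
Proof.
move=> projA C J Q p idJ quoJ s.
have [t pt] := projA C J Q p idJ quoJ (hom_comp s fp_in).
apply: (fp_lift (t := t)) => [q|]; last exact: pt.
by case: quoJ => pT _ _; have [c _ <-] : range p q by [rewrite pT]; exists c.
Qed.

Lemma fp_semiprojective : semiprojective A -> semiprojective fp.
Proof.
move=> projA C J Q q Qoo qoo r idJ incJ quoJ quoJoo rq s.
have [k [t rt]] := projA C J Q q Qoo qoo r idJ incJ quoJ quoJoo rq (hom_comp s fp_in).
exists k; apply: (fp_lift (t := t)) => [x|]; last exact: rt.
(* [r k] is onto because the surjection [qoo] factors through it. *)
case: quoJoo => pT _ _; have [c _ <-] : range qoo x by rewrite pT.
by exists (q k c).
Qed.

End FreeProduct.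

(** * A dense sequence compatible with the generators *)

Section DenseSequence.
Variables (R : realType) (A : cstarAlgType R).
Local Notation U := (fp A).

(* The only consequence needed of u lying in the algebra generated by A and the
   generators of index less than n. *)
Definition level (n : nat) (u : U) : Prop :=
  forall (D : cstarAlgType R) (h h' : U ~*> D),
  (forall a, h (fp_in A a) = h' (fp_in A a)) ->
  (forall j, (j < n)%N -> h (fp_gen A j) = h' (fp_gen A j)) -> h u = h' u.

Lemma level_le m n u : (m <= n)%N -> level m u -> level n u.
Proof.
by move=> mn um D h h' ha hn; apply: um => // j jm; apply/hn/(leq_trans jm).
Qed.

Lemma level_scale_add n (c : R[i]) u v : level n u -> level n v -> level n (c *: u + v).
Proof. by move=> un vn D h h' ha hn; rewrite !homE (un D h h')// (vn D h h'). Qed.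

Lemma level_mul n u v : level n u -> level n v -> level n (u *c v).
Proof. by move=> un vn D h h' ha hn; rewrite !homE (un D h h')// (vn D h h'). Qed.

Lemma level_star n u : level n u -> level n (star u).
Proof. by move=> un D h h' ha hn; rewrite !homE (un D h h'). Qed.

Lemma level0 n : level n 0.
Proof. by move=> D h h' _ _; rewrite !hom0. Qed.

Definition rat_complex (q : rat * rat) : R[i] := ratr q.1 +i* ratr q.2.

Lemma rat_complex_dense (c : R[i]) (e : R) : 0 < e ->
  exists q, Normc.normc (c - rat_complex q) <= e.
Proof.
have near (x : R) : 0 < e -> exists q : rat, `|x - ratr q| <= e / 2.
  move=> e0; have [|q] := @rat_in_itvoo R (x - e / 2) (x + e / 2).
    by rewrite ltrBlDr -addrA ltrDl -splitr.
  by rewrite in_itv/= => /andP[q1 q2]; exists q; rewrite ler_distlC ltW// ltW.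
case: c => a b e0; have [p pa] := near a e0; have [q qb] := near b e0.
exists (p, q); rewrite -[_ - _]/((a - ratr p) +i* (b - ratr q)).
have -> : (a - ratr p) +i* (b - ratr q) =
    (a - ratr p)%:C + (0 +i* (b - ratr q)) :> R[i].
  by rewrite -[RHS]/((_ + 0) +i* (0 + _)) addr0 add0r.
rewrite (le_trans (le_normcD _ _))//= !expr0n/= addr0 add0r !sqrtr_sqr.
by rewrite (splitr e) lerD.
Qed.

Lemma dense_nrm (S : set A) : dense S ->
  forall (a : A) (e : R), 0 < e -> exists2 s, S s & nrm (a - s) < e.
Proof.
move=> dS a e e0; have [||s [/= sa Ss]] := dS (ball a e%:C).
- by exists a; apply: ballxx; rewrite ltcR.
- exact: ball_open.
by exists s => //; move: sa; rewrite -ball_normE/= normE ltcR.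
Qed.

Variables (S0 : set A) (S0_countable : countable S0) (S0_dense : dense S0).

(** All operations are packed into one map with a countable index, so that each generation step is
    the image of a countable product. *)
Definition ratalg_op (w : (rat * rat + bool) * (U * U)) : U :=
  match w.1 with
  | inl q => rat_complex q *: w.2.1 + w.2.2
  | inr true => w.2.1 *c w.2.2
  | inr false => star w.2.1
  end.

Fixpoint ratalg_step (m : nat) : set U :=
  if m is m'.+1 then ratalg_op @` (setT `*` (ratalg_step m' `*` ratalg_step m'))
  else (fp_in A @` S0) `|` range (fp_gen A).

Definition ratalg : set U := \bigcup_m ratalg_step m.

Lemma countable_ratalg : countable ratalg.
Proof.
apply: bigcup_countable => // m _; elim: m => [|m IH] /=.
  rewrite -bigcup2E; apply: bigcup_countable => // -[|[|i]] _ /=.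
  - exact: sub_countable (card_image_le _ _) S0_countable.
  - exact: sub_countable (card_image_le _ _) (countableP _).
  - exact: countable0.
apply: sub_countable (card_image_le _ _) _.
by apply: countableX; [exact: countableP | exact: countableX].
Qed.

Lemma ratalg_step_le m n : (m <= n)%N -> ratalg_step m `<=` ratalg_step n.
Proof.
move=> /subnKC <-; elim: (n - m)%N => [|d IH]; rewrite ?addn0// addnS => u /IH um.
(* The combination 0 u + u returns u, so the steps are increasing. *)
exists (inl (0, 0), (u, u)) => //; rewrite /ratalg_op/=.
suff -> : rat_complex (0, 0) = 0 by rewrite scale0r add0r.
by rewrite /rat_complex/= rmorph0.
Qed.

Lemma ratalg_op_closed i u v : ratalg u -> ratalg v -> ratalg (ratalg_op (i, (u, v))).
Proof.
move=> [m _ um] [n _ vn]; exists (maxn m n).+1 => //.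
exists (i, (u, v)) => //; split=> //; split=> /=.
  exact: ratalg_step_le (leq_maxl _ _) _ um.
exact: ratalg_step_le (leq_maxr _ _) _ vn.
Qed.

Lemma ratalg_level u : ratalg u -> exists n, level n u.
Proof.
move=> [m _]; elim: m u => [u [[a _ <-]|[n _ <-]]|m IH u].
- by exists 0%N => D h h' ha _; exact: ha.
- by exists n.+1 => D h h' _; apply.
move=> [[i [v w]] [_ [/= /IH[n vn] /IH[p wp]]] <-]; exists (maxn n p).
have {}vn := level_le (leq_maxl n p) vn; have {}wp := level_le (leq_maxr n p) wp.
case: i => [q|[]]; rewrite /ratalg_op/=.
- exact: level_scale_add.
- exact: level_mul.
- exact: level_star.
Qed.

Definition adherent (u : U) := forall e : R, 0 < e -> exists2 s, ratalg s & nrm (u - s) <= e.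

Lemma adherent_in a : adherent (fp_in A a).
Proof.
move=> e e0; have [s Ss sa] := dense_nrm S0_dense a e0.
exists (fp_in A s); first by exists 0%N => //; left; exists s.
by rewrite -homN -homD (le_trans (hom_contr _ _))// ltW.
Qed.

Lemma adherent_gen n : adherent (fp_gen A n).
Proof.
move=> e e0; exists (fp_gen A n); last by rewrite subrr nrm0 ltW.
by exists 0%N => //; right; exists n.
Qed.

Lemma ratalg0 : ratalg 0.
Proof.
pose x := fp_gen A 0; have Sx : ratalg x by exists 0%N => //; right; exists 0%N.
rewrite (_ : 0 = ratalg_op (inl (-1, 0), (x, x))); first exact: ratalg_op_closed.
rewrite /ratalg_op /= (_ : rat_complex _ = -1) ?scaleN1r ?addNr//.
by rewrite /rat_complex/= rmorph0 rmorphN1 -[RHS]/((-1) +i* (- 0)) oppr0.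
Qed.

Lemma adherent_scale c u : adherent u -> adherent (c *: u).
Proof.
(* The error is at most d (|c| + |s|); the cap d at most 1 gives |s| at most |u| + 1, whence [M]. *)
move=> uS e e0; set M := Normc.normc c + (nrm u + 1).
have M0 : 0 < M by rewrite ltr_wpDl ?normc_ge0// ltr_wpDl ?nrm_ge0.
pose d : R := Num.min 1 (e / M).
have d0 : 0 < d by rewrite lt_min ltr01 divr_gt0.
have d1 : d <= 1 by rewrite ge_min lexx.
have [s Ss us] := uS d d0; have [q cq] := rat_complex_dense c d0.
exists (rat_complex q *: s).
  by rewrite -[_ *: _]addr0; apply: (ratalg_op_closed (inl q)) => //; exact: ratalg0.
have -> : c *: u - rat_complex q *: s = c *: (u - s) + (c - rat_complex q) *: s.
  by lmod.
rewrite (le_trans (nrmD _ _))// !nrmZ (@le_trans _ _ (d * M))//; last first.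
  by rewrite -ler_pdivlMr// ge_min lexx orbT.
rewrite mulrDr lerD//; first by rewrite mulrC ler_wpM2r ?normc_ge0.
rewrite ler_pM ?normc_ge0 ?nrm_ge0//.
by rewrite -(subrK u s) addrC (le_trans (nrmD _ _))// lerD2l nrm_distC (le_trans us).
Qed.

Lemma adherent_add u v : adherent u -> adherent v -> adherent (u + v).
Proof.
move=> uS vS e e0; have e20 : 0 < e / 2 by rewrite divr_gt0.
have [s Ss us] := uS _ e20; have [t St vt] := vS _ e20.
exists (s + t).
  rewrite (_ : s + t = ratalg_op (inl (1, 0), (s, t))); first exact: ratalg_op_closed.
  rewrite /ratalg_op/= (_ : rat_complex _ = 1) ?scale1r//.
  by rewrite /rat_complex/= rmorph0 rmorph1.
by rewrite opprD addrACA (le_trans (nrmD _ _))// (splitr e) lerD.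
Qed.

Lemma adherent_mul u v : adherent u -> adherent v -> adherent (u *c v).
Proof.
move=> uS vS e e0; set M := nrm u + (nrm v + 1).
have M0 : 0 < M by rewrite ltr_wpDl ?nrm_ge0// ltr_wpDl ?nrm_ge0.
pose d : R := Num.min 1 (e / M).
have d0 : 0 < d by rewrite lt_min ltr01 divr_gt0.
have d1 : d <= 1 by rewrite ge_min lexx.
have [s Ss us] := uS d d0; have [t St vt] := vS d d0.
exists (s *c t); first exact: (ratalg_op_closed (inr true)).
have -> : u *c v - s *c t = u *c (v - t) + (u - s) *c t by rewrite !cmulE; lmod.
rewrite (le_trans (nrmD _ _))// (@le_trans _ _ (d * M))//; last first.
  by rewrite -ler_pdivlMr// ge_min lexx orbT.
rewrite mulrDr lerD// (le_trans (nrmM _ _))//.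
  by rewrite mulrC ler_wpM2r ?nrm_ge0.
rewrite ler_pM ?nrm_ge0//.
by rewrite -(subrK v t) addrC (le_trans (nrmD _ _))// lerD2l nrm_distC (le_trans vt).
Qed.

Lemma adherent_star u : adherent u -> adherent (star u).
Proof.
move=> uS e /uS[s Ss us]; exists (star s).
  exact: (ratalg_op_closed (inr false) Ss Ss).
by rewrite -starN -starD nrm_star.
Qed.

Lemma ratalg_dense u (e : R) : 0 < e -> exists2 s, ratalg s & nrm (u - s) <= e.
Proof.
move=> e0; have e20 : 0 < e / 2 by rewrite divr_gt0.
have [t ut] := teval_dense u e20.
suff /(_ _ e20)[s Ss ts] : adherent (teval (@ugen R (fp_pres A)) t).
  exists s => //; rewrite (le_trans (nrm_distD (teval (@ugen R (fp_pres A)) t) _ _))//.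
  by rewrite (splitr e) lerD.
elim: t {ut} => [[a|n]||t IHt v IHv|t IHt|c t IHt|t IHt v IHv|t IHt] /=.
- exact: adherent_in.
- exact: adherent_gen.
- by move=> d d0; exists 0; [exact: ratalg0 | rewrite subrr nrm0 ltW].
- exact: adherent_add.
- by rewrite -scaleN1r; exact: adherent_scale.
- exact: adherent_scale.
- exact: adherent_mul.
- exact: adherent_star.
Qed.

(* Each index m is the 2-adic valuation of arbitrarily large n, which leaves
   room to delay the m-th element of [ratalg] until it has level n. *)
Lemma dense_level_seq : exists d : nat -> U,
  [/\ forall n, nrm (d n) <= 1, forall n, level n (d n) &
      forall u, nrm u <= 1 -> exists n, nrm (u - d n) <= 2^-1].
Proof.
have /countable_injP[f finj] := countable_ratalg.
(* At most one element, since the code [f] is injective; where there is none, [d0] takes the value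
   0, which has every level. *)
pose pick n := [set s | [/\ ratalg s, f s = logn 2 n & level n s]].
pose d0 n : U := xget 0 (pick n).
have d0_level n : level n (d0 n).
  by rewrite /d0; case: xgetP => [s _ []//|_]; exact: level0.
have d0_surj s : ratalg s -> exists n, d0 n = s.
  move=> Ss; have [l ls] := ratalg_level Ss; exists (2 ^ f s * (l.*2).+1)%N.
  apply: xget_unique => [|t [St ft _]].
    split=> //.
      rewrite lognM ?expn_gt0// pfactorK// (_ : logn 2 _ = 0%N) ?addn0//.
      by apply/eqP; rewrite lognE/= dvdn2/= odd_double.
    apply: level_le ls; rewrite (@leq_trans l.*2.+1)//.
      by rewrite -addnn leqW// leq_addr.
    by rewrite leq_pmull// expn_gt0.
  apply/esym/finj; rewrite ?inE// ft lognM ?expn_gt0// pfactorK//.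
  rewrite (_ : logn 2 _ = 0%N) ?addn0//.
  by apply/eqP; rewrite lognE/= dvdn2/= odd_double.
(* Radial retraction onto the unit ball; scaling does not affect the level. *)
pose d n : U := (Num.max 1 (nrm (d0 n)))^-1%:C *: d0 n.
have m0 n : 0 < Num.max 1 (nrm (d0 n)) by rewrite lt_max ltr01.
exists d; split=> [n|n|u u1].
- rewrite nrmZr gtr0_norm ?invr_gt0// mulrC ler_pdivrMr// mul1r.
  by rewrite le_max lexx orbT.
- by rewrite /d -[_ *: _]addr0; apply: level_scale_add => //; exact: level0.
(* 1/4 for approximating u by s, and another 1/4 for retracting s, whose norm is at most 1 + 1/4. *)
have [|s /d0_surj[n ds] us] := @ratalg_dense u 4^-1; first by rewrite invr_gt0.
exists n; apply: le_trans (nrm_distD s _ _) _.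
suff : nrm (s - d n) <= 4^-1 by lra.
have [s1|s1] := leP (nrm s) 1.
  rewrite /d ds (_ : Num.max _ _ = 1) ?invr1 ?scale1r ?subrr ?nrm0 ?invr_ge0//.
  by apply/max_idPl.
have dE : d n = (nrm s)^-1%:C *: s.
  by rewrite /d ds (_ : Num.max _ _ = nrm s)//; apply/max_idPr/ltW.
have -> : s - d n = (1 - (nrm s)^-1)%:C *: s.
  by rewrite dE rmorphB rmorph1/=; lmod.
have s0 : 0 < nrm s by apply: lt_trans s1.
rewrite nrmZr ger0_norm ?subr_ge0 ?invf_le1 ?(ltW s1)//.
rewrite mulrBl mul1r mulVf ?gt_eqF//.
have : nrm s <= nrm u + 4^-1.
  by rewrite -(subrK u s) addrC (le_trans (nrmD _ _))// lerD2l nrm_distC.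
by lra.
Qed.

End DenseSequence.

(** * Inductive limits *)

Section InductiveLimit.
Variables (R : realType) (A : nat -> cstarAlgType R).
Variable gamma : forall k, A k ~*> A k.+1.

Definition lim_pres : presentation R.
Proof.
refine (@Presentation R {k & A k}
  (fun D y => exists f : forall k, A k ~*> D,
     is_cocone gamma f /\ forall k a, y (existT A k a) = f k a)
  (fun g => nrm (projT2 g)) _).
by move=> D y [f [_ yf]] [k a]; rewrite yf hom_contr.
Defined.

Definition ind_lim : cstarAlgType R := univ lim_pres.

Definition lim_fun k (a : A k) : ind_lim := @ugen R lim_pres (existT A k a).

Program Definition lim_in k : A k ~*> ind_lim := @StarHom R (A k) ind_lim (@lim_fun k) _ _ _.
Next Obligation.
move=> k c a b; apply: univ_hom_ext => D h [f [_ hf]].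
by rewrite !homE [LHS]hf !homE -!hf.
Qed.
Next Obligation.
move=> k a b; apply: univ_hom_ext => D h [f [_ hf]].
by rewrite !homE [LHS]hf !homE -!hf.
Qed.
Next Obligation.
move=> k a; apply: univ_hom_ext => D h [f [_ hf]].
by rewrite !homE [LHS]hf !homE -!hf.
Qed.

Lemma ind_limP : is_inductive_limit gamma lim_in.
Proof.
split=> [k a|D f fc].
  apply: univ_hom_ext => D h [f [fc hf]].
  by rewrite [LHS]hf fc; exact/esym/hf.
have yP : @reps R lim_pres D (fun g => f (projT1 g) (projT2 g)) by exists f.
split; first by exists (uhom yP) => k a; exact: (uhom_gen yP (existT A k a)).
by move=> h h' hf h'f; apply: hom_ext => -[k a]; rewrite [LHS]hf; exact/esym/h'f.
Qed.

End InductiveLimit.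

(** * The system with surjective connecting morphisms *)

Section SurjectiveSystem.
Variables (R : realType) (A : nat -> cstarAlgType R).
Variable gamma : forall k, A k ~*> A k.+1.
Variable d : forall k, nat -> fp (A k).
Hypothesis d1 : forall k n, nrm (d k n) <= 1.
Hypothesis d_level : forall k n, level n (d k n).
Hypothesis d_dense : forall k (u : fp (A k)), nrm u <= 1 ->
  exists n, nrm (u - d k n) <= 2^-1.

Definition delta k : fp (A k) ~*> fp (A k.+1) :=
  fp_hom (hom_comp (fp_in (A k.+1)) (gamma k)) (d1 k.+1).

Lemma delta_in k a : delta k (fp_in (A k) a) = fp_in (A k.+1) (gamma k a).
Proof. exact: fp_hom_in. Qed.

Lemma delta_gen k n : delta k (fp_gen (A k) n) = d k.+1 n.
Proof. exact: fp_hom_gen. Qed.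

Lemma delta_surj k : range (delta k) = setT.
Proof.
apply/seteqP; split=> // u _.
have [v u1|v <-] := @half_dense_surj _ _ _ (delta k) _ u; last by exists v.
have [n vn] := d_dense u1.
by exists (fp_gen (A k) n); [exact: nrm_fp_gen | rewrite delta_gen].
Qed.

(* Since [d k n] only involves generators of index less than n, the generator
   of index n is mapped into A after n + 1 steps. *)
Section Stages.
Variables (L : cstarAlgType R) (l : forall k, A k ~*> L) (lc : is_cocone gamma l).

(** Applies m connecting morphisms and sends the generators left over to 0. By [stage_gen] this
    truncation does not affect x_n once m > n. *)
Fixpoint stage m : forall k, fp (A k) ~*> L :=
  if m is m'.+1 then fun k => hom_comp (stage m' k.+1) (delta k)
  else fun k => @fp_hom R (A k) L (l k) (fun=> 0) (fun=> ltac:(by rewrite nrm0)).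

Lemma stage_in m k a : stage m k (fp_in (A k) a) = l k a.
Proof.
elim: m k a => [|m IH] k a; first exact: fp_hom_in.
by rewrite -[LHS]/(stage m k.+1 (delta k (fp_in (A k) a))) delta_in IH lc.
Qed.

(** One step turns x_n into [d k.+1 n], determined by A and the x_j with j < n; the remaining
    numbers of steps still exceed every such j. *)
Lemma stage_gen n m m' k : (n < m)%N -> (n < m')%N ->
  stage m k (fp_gen (A k) n) = stage m' k (fp_gen (A k) n).
Proof.
elim/ltn_ind: n m m' k => n IH [//|m] [//|m'] k nm nm'.
rewrite -[LHS]/(stage m k.+1 (delta k (fp_gen (A k) n))).
rewrite -[RHS]/(stage m' k.+1 (delta k (fp_gen (A k) n))) delta_gen.
apply: d_level => [a|j jn]; first by rewrite !stage_in.
by apply: IH => //; exact: leq_trans jn _.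
Qed.

Definition stage_lim_gen k n : L := stage n.+1 k (fp_gen (A k) n).

Lemma nrm_stage_lim_gen k n : nrm (stage_lim_gen k n) <= 1.
Proof. exact: le_trans (hom_contr _ _) (nrm_fp_gen _ _). Qed.

Definition stage_lim k : fp (A k) ~*> L := fp_hom (l k) (nrm_stage_lim_gen k).

Lemma stage_lim_in k a : stage_lim k (fp_in (A k) a) = l k a.
Proof. exact: fp_hom_in. Qed.

Lemma stage_lim_cocone : is_cocone delta stage_lim.
Proof.
move=> k; apply: (fp_hom_ext (h := hom_comp (stage_lim k.+1) (delta k))) => [a|n].
  rewrite -[LHS]/(stage_lim k.+1 (delta k (fp_in (A k) a))).
  by rewrite delta_in !stage_lim_in lc.
rewrite -[LHS]/(stage_lim k.+1 (delta k (fp_gen (A k) n))).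
have -> : stage_lim k (fp_gen (A k) n) = stage n k.+1 (delta k (fp_gen (A k) n)).
  exact: fp_hom_gen.
(* One of the n + 1 steps defining the image of x_n has been spent; the n that remain suffice for
   x_j with j < n. *)
rewrite delta_gen; apply: d_level => [a|j jn].
  by rewrite stage_lim_in stage_in.
have -> : stage_lim k.+1 (fp_gen (A k.+1) j) = stage j.+1 k.+1 (fp_gen (A k.+1) j).
  exact: fp_hom_gen.
exact: stage_gen.
Qed.

(** A cocone on the B_k restricts to the A_k, which determines h. Agreement on x_n follows by strong
    induction: both cocones factor through the next stage, where x_n has become an element of level
    n. *)
Lemma stage_lim_inductive : is_inductive_limit gamma l ->
  is_inductive_limit delta stage_lim.
Proof.
move=> [_ lU]; split=> [|D f fc]; first exact: stage_lim_cocone.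
have fc' : is_cocone gamma (fun k => hom_comp (f k) (fp_in (A k))).
  by move=> k a; rewrite -[RHS]/(f k (fp_in (A k) a)) -fc delta_in.
have [[h hf] hU] := lU D _ fc'.
split; last first.
  by move=> h1 h2 h1f h2f; apply: hU => k a; rewrite -stage_lim_in; [exact: h1f | exact: h2f].
exists h => k; apply: (fp_hom_ext (h := hom_comp h (stage_lim k))) => [a|n].
  by rewrite -[LHS]/(h (stage_lim k (fp_in (A k) a))) stage_lim_in hf.
elim/ltn_ind: n k => n IH k; rewrite -[LHS]/(h (stage_lim k (fp_gen (A k) n))).
rewrite -stage_lim_cocone -fc delta_gen.
rewrite -[LHS]/(hom_comp h (stage_lim k.+1) (d k.+1 n)).
apply: d_level => [a|j jn]; last exact: IH.
by rewrite -[LHS]/(h (stage_lim k.+1 (fp_in (A k.+1) a))) stage_lim_in hf.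
Qed.

End Stages.

End SurjectiveSystem.

Theorem proposition4p8 (R : realType) (A : nat -> cstarAlgType R)
    (gamma : forall k, A k ~*> A k.+1)
    (sepA : forall k, separable (A k)) :
  exists (F : cstarAlgType R) (x : nat -> F)
    (B : nat -> cstarAlgType R) (delta : forall k, B k ~*> B k.+1)
    (iA : forall k, A k ~*> B k) (iF : forall k, F ~*> B k),
  [/\ is_universal_contractions x,
      forall k, is_free_product (iA k) (iF k),
      forall k, range (delta k) = setT,
      exists (LA LB : cstarAlgType R)
        (lA : forall k, A k ~*> LA) (lB : forall k, B k ~*> LB),
        [/\ is_inductive_limit gamma lA,
            is_inductive_limit delta lB & isomorphic LA LB] &
      forall k, (projective (A k) -> projective (B k)) /\
                (semiprojective (A k) -> semiprojective (B k))].
Proof.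
have [d dP] : exists d : forall k, nat -> fp (A k), forall k,
    [/\ forall n, nrm (d k n) <= 1, forall n, level n (d k n) &
        forall u, nrm u <= 1 -> exists n, nrm (u - d k n) <= 2^-1].
  have dense_seq k := let: ex_intro2 _ S0c S0d := sepA k in dense_level_seq S0c S0d.
  by exists (fun k => projT1 (cid (dense_seq k))) => k; exact: projT2 (cid (dense_seq k)).
have d1 k n : nrm (d k n) <= 1 by case: (dP k).
have d_level k n : level n (d k n) by case: (dP k).
have d_dense k u : nrm u <= 1 -> exists n, nrm (u - d k n) <= 2^-1.
  by case: (dP k) => _ _; exact.
have limA := ind_limP gamma; have [lc _] := limA.
exists (Finfty R), (Fgen R), (fun k => fp (A k)), (delta gamma d1).
exists (fun k => fp_in (A k)), (fun k => fp_inF (A k)); split.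
- exact: Finfty_universal.
- by move=> k; exact: fp_free_product.
- by move=> k; exact: delta_surj.
(* The limit of the A_k itself carries the cocone of the B_k, so the isomorphism is the identity. *)
- exists (ind_lim gamma), (ind_lim gamma), (lim_in gamma).
  exists (stage_lim gamma d1 (lim_in gamma)); split=> //.
    exact: stage_lim_inductive.
  by exists (hom_id _), (hom_id _).
- by move=> k; split; [exact: fp_projective | exact: fp_semiprojective].
Qed.
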